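(* Let $\delta=\delta(n)$ satisfy $\delta=O(1/\sqrt{n})$, and let $\beta=1\pm\delta$. Then the mixing time $t_{\mathrm{mix}}(1/4)$ of the Glauber dynamics for the mean-field Ising model on $n$ vertices with parameter $\beta$ has order $n^{3/2}$, and the dynamics does not exhibit cutoff. In addition, the spectral gap of the dynamics has order $n^{-3/2}$.
   Context: For $n\ge1$ and $\beta\ge0$, the mean-field (Curie–Weiss) Ising measure $\mu_n$ on $\Omega=\{1,-1\}^n$ is $\mu_n(\sigma)\propto\exp\big(\frac{\beta}{n}\sum_{x<y}\sigma(x)\sigma(y)\big)$. The (heat-bath) Glauber dynamics $(X_t)$ is the Markov chain on $\Omega$ which at each step chooses a vertex uniformly at random and replaces its spin by a spin drawn from $\mu_n$ conditioned on the spins at all other vertices. Let $d_n(t)=\max_{\sigma}\|\mathbb{P}_\sigma(X_t\in\cdot)-\mu_n\|_{\mathrm{TV}}$ and $t_{\mathrm{mix}}(\epsilon)=\min\{t:d_n(t)\le\epsilon\}$. The spectral gap is $1-\lambda$, with $\lambda$ the largest absolute value of a nontrivial eigenvalue of the transition kernel. A quantity ''has order $f(n)$'' if it lies between $cf(n)$ and $Cf(n)$ for constants $0<c<C$ and all large $n$. The family exhibits cutoff if there is a sequence $w_n=o(t_{\mathrm{mix}}(1/4))$ such that for every $0<\epsilon<1$ there is $c_\epsilon>0$ with $t_{\mathrm{mix}}(\epsilon)-t_{\mathrm{mix}}(1-\epsilon)\le c_\epsilon w_n$ for all $n$. *)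

(* Defs.v *)
From HB Require Import structures.
From mathcomp Require Import all_boot all_order all_algebra.
From mathcomp Require Import all_classical all_reals all_analysis.
Set Implicit Arguments. Unset Strict Implicit. Unset Printing Implicit Defensive.
Import Order.TTheory GRing.Theory Num.Theory.
Local Open Scope ring_scope.

Section CurieWeiss.
Variable R : realType.

Definition config (n : nat) := {ffun 'I_n -> bool}.

Definition spin (b : bool) : R := if b then 1 else -1.

Definition cw_weight (n : nat) (beta : R) (s : config n) : R :=
  expR (beta / n%:R * \sum_(x : 'I_n) \sum_(y : 'I_n | (x < y)%N)
                        spin (s x) * spin (s y)).

Definition cw_mu (n : nat) (beta : R) (s : config n) : R :=
  cw_weight beta s / \sum_(t : config n) cw_weight beta t.

Definition upd (n : nat) (s : config n) (v : 'I_n) (b : bool) : config n :=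
  [ffun w => if w == v then b else s w].

(* Heat-bath Glauber transition kernel: choose v uniformly, resample the spin
   at v from mu_n conditioned on the spins off v. *)
Definition glauber (n : nat) (beta : R) (s t : config n) : R :=
  n%:R^-1 * \sum_(v : 'I_n)
    (if [forall w, (w != v) ==> (t w == s w)]
     then cw_mu beta t / (cw_mu beta (upd s v true) + cw_mu beta (upd s v false))
     else 0).

Definition glauber_mx (n : nat) (beta : R) : 'M[R]_#|{: config n}| :=
  \matrix_(i, j) glauber beta (enum_val i) (enum_val j).

Definition glauber_t (n : nat) (beta : R) (t : nat) (s u : config n) : R :=
  (glauber_mx n beta ^+ t) (enum_rank s) (enum_rank u).

Definition tv_dist (n : nat) (beta : R) (t : nat) (s : config n) : R :=
  2^-1 * \sum_(u : config n) `|glauber_t beta t s u - cw_mu beta u|.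

Definition dmax (n : nat) (beta : R) (t : nat) : R :=
  \big[Num.max/0]_(s : config n) tv_dist beta t s.

(* t_mix(eps) = min { t : d_n(t) <= eps } (0 if no such t exists). *)
Definition tmix (n : nat) (beta : R) (eps : R) : nat :=
  match pselect (exists t : nat, dmax n beta t <= eps) with
  | left h => ex_minn h
  | right _ => 0%N
  end.

Definition lambda_star (n : nat) (beta : R) : R :=
  sup [set `|a| | a in [set a : R | eigenvalue (glauber_mx n beta) a && (a != 1)]].

Definition spectral_gap (n : nat) (beta : R) : R := 1 - lambda_star n beta.

Definition has_order (x f : nat -> R) : Prop :=
  exists c C : R, 0 < c /\ c < C /\
    exists N : nat, forall n : nat, (N <= n)%N -> c * f n <= x n <= C * f n.

Definition has_cutoff (beta : nat -> R) : Prop :=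
  exists w : nat -> R,
    (forall e : R, 0 < e -> exists N : nat, forall n : nat, (N <= n)%N ->
        `|w n| <= e * (tmix n (beta n) (4^-1))%:R) /\
    (forall eps : R, 0 < eps < 1 -> exists c : R, 0 < c /\
        forall n : nat, (1 <= n)%N ->
          (tmix n (beta n) eps)%:R - (tmix n (beta n) (1 - eps))%:R <= c * w n).

End CurieWeiss.

(* Main.v *)
(* The mixing time bound comes from two couplings. Exchanging the spins at two vertices
   is forgotten at rate 1/n by a coupling that keeps the magnetization equal, so after
   order n log n steps only the number of plus spins matters. That number is a
   birth-death chain with drift -(1 - beta) m - m^3 / 3 in the normalized magnetization
   m, up to constants. For two copies at distance d the difference of the drifts is at
   most K d / n^(3/2) - c d^3 / n^3, and an explicit concave function of d, bounded by
   O(n^(3/2)) and decreasing by 1 per step in mean, bounds the meeting time.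

   Conversely, stationarity of the second and fourth powers of the magnetization S
   forces E S^2 >= c n^(3/2), while the Dirichlet form of S is at most 2; the maximizer
   of the Rayleigh quotient is therefore an eigenfunction with eigenvalue
   l >= 1 - O(n^(-3/2)). Since |a|^t <= 2 d_n(t) for every eigenvalue a <> 1, this
   gives the lower bound on the mixing time and both bounds on the gap. It also gives
   t_mix(eps) >= A n^(3/2) for arbitrary A when eps is small, which excludes cutoff. *)
Require Import Defs.
From HB Require Import structures.
From mathcomp Require Import all_boot all_order all_fingroup all_algebra.
From mathcomp Require Import all_classical all_reals all_analysis.
From mathcomp Require Import ring lra zify.
Import Order.TTheory GRing.Theory Num.Theory.
Import numFieldNormedType.Exports.
Local Open Scope ring_scope.
Set Implicit Arguments.
Unset Strict Implicit.
Unset Printing Implicit Defensive.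

(** * Hyperbolic tangent *)

Section Tanh.
Variable R : realType.
Implicit Types x y u : R.

(** No probability space appears: the chains act on test functions through [glauber_op] and
    [bd_step], a coupling is an operator on functions of two arguments, and mixing is the shrinking
    of oscillations. The obstacle near [beta = 1] is that the linear part of the drift vanishes or
    even repels, so two copies attract only cubically. The term [d^3] is available wherever the
    copies sit, because the hyperbolic tangent grows most over an interval centred at 0 and even
    there falls short of linear growth by a cubic amount. With [h = n^(-3/4)] the drift difference
    is [K d h^2 - c d^3 h^4]: the two terms balance at [d] of order [1 / h], and diffusing that far
    takes [h^(-2) = n^(3/2)] steps. Near the centre every rate is about 1/4, so four separate moves
    of a pair would use up the total probability and a perturbation could exceed it. Hence the
    coupling overlaps two moves; the overlap can widen the distance by two, which a concave function
    of the distance tolerates. *)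

Definition th x : R := 1 - 2 / (1 + expR (2 * x)).

Lemma thE x : th x = (expR (2 * x) - 1) / (expR (2 * x) + 1).
Proof. by rewrite /th; field; rewrite gt_eqF// ltr_wpDl ?expR_ge0. Qed.

Lemma th0 : th 0 = 0.
Proof. by rewrite thE mulr0 expR0 subrr mul0r. Qed.

Lemma thN x : th (- x) = - th x.
Proof.
rewrite !thE mulrN expRN; have := expR_gt0 (2 * x).
by move: (expR _) => e e0; field; rewrite !gt_eqF ?addr_gt0.
Qed.

Lemma th_lt1 x : th x < 1.
Proof. by rewrite /th ltrBlDr ltrDl divr_gt0// addr_gt0// expR_gt0. Qed.

Lemma th_gtN1 x : -1 < th x.
Proof. by rewrite -ltrN2 opprK -thN th_lt1. Qed.

Lemma th_le x y : x <= y -> th x <= th y.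
Proof.
move=> xy; rewrite /th lerB// ler_pM2l// lef_pV2 ?posrE ?addr_gt0 ?expR_gt0//.
by rewrite lerD2l ler_expR ler_pM2l.
Qed.

Lemma th_ge0 x : 0 <= x -> 0 <= th x.
Proof. by rewrite -{2}th0; exact: th_le. Qed.

Lemma th_sub x y : th (x - y) * (1 - th x * th y) = th x - th y.
Proof.
have E : expR (2 * (x - y)) = expR (2 * x) / expR (2 * y).
  by rewrite mulrBr expRD expRN.
rewrite !thE E; have := expR_gt0 (2 * x); have := expR_gt0 (2 * y).
move: (expR _) (expR _) => b a b0 a0.
by field; rewrite !gt_eqF ?addr_gt0.
Qed.

Lemma th_double x : th (2 * x) * (1 + th x ^+ 2) = 2 * th x.
Proof.
have -> : 2 * x = x - (- x) by ring.
have := th_sub x (- x); rewrite thN => h.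
by rewrite (_ : 1 + _ = 1 - th x * - th x) ?h; ring.
Qed.

(* The increment over an interval of given length is largest when the
   interval is centred at 0. *)
Lemma th_incr_le x y : x <= y -> th y - th x <= 2 * th ((y - x) / 2).
Proof.
move=> xy; set s := th ((y - x) / 2); set c := th ((y + x) / 2).
have s0 : 0 <= s by apply: th_ge0; lra.
have s1 : s < 1 by exact: th_lt1.
have c1 : c < 1 by exact: th_lt1.
have c2 : -1 < c by exact: th_gtN1.
have Ey : th y * (1 + s * c) = c + s.
  have := th_sub ((y + x) / 2) (- ((y - x) / 2)); rewrite thN -/s -/c.
  by rewrite (_ : _ - _ = y); [move=> h; have : th y * (1 - c * - s) = c - (- s) := h; nra | field].
have Ex : th x * (1 - s * c) = c - s.
  have := th_sub ((y + x) / 2) ((y - x) / 2); rewrite -/s -/c.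
  by rewrite (_ : _ - _ = x); [nra | field].
have p1 : 0 < 1 + s * c by nra.
have p2 : 0 < 1 - s * c by nra.
have -> : th y = (c + s) / (1 + s * c) by rewrite -Ey mulfK// gt_eqF.
have -> : th x = (c - s) / (1 - s * c) by rewrite -Ex mulfK// gt_eqF.
have -> : (c + s) / (1 + s * c) - (c - s) / (1 - s * c) =
    2 * s * ((1 - c ^+ 2) / (1 - (s * c) ^+ 2)).
  by field; rewrite !gt_eqF//= subr_gt0; nra.
have q : 0 < 1 - (s * c) ^+ 2 by nra.
rewrite ler_piMr ?mulr_ge0// ler_pdivrMr// mul1r lerB// exprMn.
by rewrite ler_piMl ?sqr_ge0//; nra.
Qed.

Lemma is_derive_th x : is_derive x 1 th (1 - th x ^+ 2).
Proof.
have e0 := expR_gt0 (2 * x).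
have n0 : 1 + expR (2 * x) != 0 by rewrite gt_eqF// addr_gt0.
have dE : is_derive x 1 (fun y : R => expR (2 * y)) (2 * expR (2 * x)).
  have -> : (fun y : R => expR (2 * y)) = (fun y : R => expR y ^+ 2) by apply/funext => y; exact: (expRM_natl 2).
  by apply: is_derive_eq; rewrite (expRM_natl 2) /GRing.scale /=; ring.
have dF : is_derive x 1 (fun y : R => 1 + expR (2 * y)) (2 * expR (2 * x)).
  by rewrite -[X in is_derive _ _ _ X]add0r; apply: is_deriveD.
have dV := @is_deriveV R (fun y : R => 1 + expR (2 * y)) x _ 1 n0 dF.
rewrite (_ : th = fun x => 1 - 2 * (1 + expR (2 * x))^-1)//.
apply: is_derive_eq.
rewrite /th /GRing.scale /=.
by move: (expR _) n0 e0 => e n0 e0; field.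
Qed.

Lemma th_mvt x : 0 <= x ->
  exists2 c, 0 <= c <= x & th x = (1 - th c ^+ 2) * x.
Proof.
move=> x0.
have [c] := @MVT_segment R th (fun y => 1 - th y ^+ 2) 0 x x0
  (fun y _ => is_derive_th y)
  (derivable_within_continuous (fun y _ => @ex_derive _ _ _ _ _ _ _ (is_derive_th y))).
by rewrite in_itv /= th0 !subr0; exists c.
Qed.

Lemma th_le_id x : 0 <= x -> th x <= x.
Proof.
by move=> x0; have [c _ ->] := th_mvt x0; rewrite ler_piMl// lerBlDr lerDl sqr_ge0.
Qed.

Lemma th_ge_cubic x : 0 <= x -> x - x ^+ 3 <= th x.
Proof.
move=> x0; have [c /andP[c0 cx] ->] := th_mvt x0.
have t0 := th_ge0 c0; have tx : th c <= x by apply: le_trans cx; exact: th_le_id.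
rewrite -subr_ge0 (_ : _ - _ = x * (x ^+ 2 - th c ^+ 2)); last by ring.
by rewrite mulr_ge0// subr_ge0 ler_sqr.
Qed.

Lemma th_ge_frac x : 0 <= x -> x <= (1 + x) * th x.
Proof.
move=> x0; rewrite thE; have := expR_ge1Dx (2 * x); move: (expR _) => e h.
by rewrite mulrA ler_pdivlMr; nra.
Qed.

(** With [t = th x] and [d = th (2 * x)], the duplication formula reads [d = 2 t - d t^2]. Since
    [d >= t] the loss is at least [t^3], and [th_ge_frac] gives [t >= x / (1 + b)]. *)
Lemma th_double_le x b : 0 <= x <= b ->
  th (2 * x) <= 2 * x - x ^+ 3 / (1 + b) ^+ 3.
Proof.
move=> /andP[x0 xb].
have := th_double x; have := th_ge0 x0; have := th_lt1 x.
have tx := th_le_id x0.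
have h : x / (1 + b) <= th x.
  rewrite ler_pdivrMr; last lra.
  by apply: le_trans (th_ge_frac x0) _; rewrite mulrC ler_wpM2l ?th_ge0// lerD2l.
have h3 : x ^+ 3 / (1 + b) ^+ 3 <= th x ^+ 3.
  by rewrite -expr_div_n lerXn2r ?nnegrE ?th_ge0// divr_ge0//; lra.
move: (th x) (th (2 * x)) tx h3 => t d tx h3 t1 t0 dd.
have {}dd : d = 2 * t - d * t ^+ 2 by lra.
have : t ^+ 3 <= d * t ^+ 2.
  have d0 : 0 <= d by nra.
  have : t <= d by nra.
  by rewrite exprS => td; rewrite ler_wpM2r// sqr_ge0.
lra.
Qed.

(** Recentring at 0 leaves [2 * th (z / 2)] for the length [z], and [th_double_le] at [z / 4]
    produces the loss [2 * (1/4)^3 = 1/32]. The bound does not depend on the position of the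
    interval. *)
Lemma th_incr_cubic x y b : 0 <= y - x <= b ->
  th y - th x <= (y - x) - (y - x) ^+ 3 / (32 * (1 + b) ^+ 3).
Proof.
move=> /andP[z0 zb].
have xy : x <= y by lra.
have := th_incr_le xy; set z := y - x in z0 zb *.
have h : 0 <= z / 4 <= b by lra.
have := th_double_le h; rewrite (_ : 2 * (z / 4) = z / 2); last by field.
have -> : (z / 4) ^+ 3 / (1 + b) ^+ 3 = (z ^+ 3 / (32 * (1 + b) ^+ 3)) / 2.
  by field; rewrite gt_eqF//; lra.
by set w := _ / (32 * _); lra.
Qed.

Lemma th_incr_le_id x y : x <= y -> th y - th x <= y - x.
Proof.
move=> xy; apply: le_trans (th_incr_le xy) _.
by have := @th_le_id ((y - x) / 2) ltac:(lra); lra.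
Qed.

End Tanh.

(** * A Lyapunov function *)

Section Lyapunov.
Variable R : realType.

(** The drift inequality for the distance function, in the rescaled distance [y = h * d]: the first
    summand comes from its geometric part, the second from its rational part. *)
Lemma lyapunov_bound (K c0 c1 : R) : 0 < K -> 0 < c0 -> 0 < c1 ->
  exists B C g : R, [/\ 0 < B, 0 < C, 0 < g &
   forall h y r : R, 0 < h <= 1 -> 0 <= y -> expR (- (g * (y + 1))) <= r ->
    1 <= B * g * r * (c0 * g + c1 * y ^+ 3 - K * y) +
      C * (c1 * y ^+ 3 - K * y) / ((1 + y) * (1 + y + h))].
Proof.
move=> K0 c00 c10.
(* Beyond [Y] the attraction [c1 * y ^+ 3] is at least twice the repulsion [K * y]. *)
pose Y := 1 + 2 * K / c1.
have Y1 : 1 < Y by rewrite /Y ltrDl divr_gt0// mulr_gt0.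
have Y0 : 0 < Y by rewrite (lt_trans _ Y1).
have YK : 2 * K <= c1 * Y ^+ 2.
  have e : c1 * Y = c1 + 2 * K by rewrite /Y; field; rewrite gt_eqF.
  by rewrite expr2 mulrA e; nra.
clearbody Y.
(* Below [Y] the curvature term [c0 * g] exceeds the repulsion by at least 1. *)
pose g := (1 + K * Y) / c0.
have g0 : 0 < g by rewrite /g divr_gt0//; nra.
have cg : c0 * g = 1 + K * Y by rewrite /g; field; rewrite gt_eqF.
clearbody g.
(* Half of the cubic term then yields [6 * y ^+ 3], which covers the denominator, at most
   [(2 * y) * (3 * y)] for [y >= 1]. *)
pose C := 12 / c1.
have C0 : 0 < C by rewrite /C divr_gt0.
have Cc : C * c1 = 12 by rewrite /C divfK// gt_eqF.
clearbody C.
pose E := expR (- (g * (Y + 1))).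
have E0 : 0 < E by exact: expR_gt0.
(* Below [Y] the second summand can fall to [- C * K * Y]; there [r >= E], and [B] pays for it. *)
pose B := (1 + C * K * Y) / (E * g).
have B0 : 0 < B.
  by apply: divr_gt0; [rewrite addr_gt0// !mulr_gt0|exact: mulr_gt0].
have BE : B * g * E = 1 + C * K * Y.
  by rewrite /B; field; rewrite !gt_eqF.
clearbody B.
exists B, C, g; split => // h y r /andP[h0 h1] y0 hr.
have r0 : 0 < r by apply: lt_le_trans hr; exact: expR_gt0.
have D0 : 0 < (1 + y) * (1 + y + h) by nra.
have [yY|yY] := leP Y y.
- have hy : c1 * y ^+ 3 / 2 <= c1 * y ^+ 3 - K * y.
    have : 2 * K <= c1 * y ^+ 2.
      apply: le_trans YK _; rewrite ler_pM2l// lerXn2r// nnegrE.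
    by apply: ltW; lra.
    rewrite -subr_ge0 => h'; rewrite -subr_ge0.
    by rewrite (_ : _ - _ = y * (c1 * y ^+ 2 - 2 * K) / 2) ?divr_ge0 ?mulr_ge0//; field.
  have y3 : 0 <= y ^+ 3 by rewrite exprn_ge0.
  have t1 : 0 <= B * g * r * (c0 * g + c1 * y ^+ 3 - K * y).
    have KY : 0 < K * Y by rewrite mulr_gt0.
    have cy : 0 <= c1 * y ^+ 3 by rewrite mulr_ge0 // ltW.
    apply: mulr_ge0; first by rewrite !mulr_ge0// ltW.
    by rewrite cg; lra.
  suff : 1 <= C * (c1 * y ^+ 3 - K * y) / ((1 + y) * (1 + y + h)) by lra.
  rewrite ler_pdivlMr// mul1r.
  have : C * (c1 * y ^+ 3 / 2) <= C * (c1 * y ^+ 3 - K * y) by rewrite ler_pM2l.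
  rewrite (_ : C * (c1 * y ^+ 3 / 2) = 6 * y ^+ 3); last first.
    by rewrite mulrA mulrA Cc; field.
  have : y ^+ 2 <= y ^+ 3 by rewrite [leRHS]exprS ler_peMl ?sqr_ge0//; lra.
  have : (1 + y) * (1 + y + h) <= (2 * y) * (3 * y) by apply: ler_pM; lra.
  by rewrite expr2; lra.
- have t1 : 1 + C * K * Y <= B * g * r * (c0 * g + c1 * y ^+ 3 - K * y).
    rewrite -BE -[leLHS]mulr1; apply: ler_pM => //.
    + by rewrite !mulr_ge0// ltW.
    + rewrite ler_pM2l ?mulr_gt0//; apply: le_trans hr.
      by rewrite /E ler_expR lerN2 ler_pM2l//; lra.
    + have : 0 <= c1 * y ^+ 3 by rewrite mulr_ge0 ?exprn_ge0// ltW.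
      by nra.
  suff : - (C * K * Y) <= C * (c1 * y ^+ 3 - K * y) / ((1 + y) * (1 + y + h)) by lra.
  have CK : 0 < C * K by rewrite mulr_gt0.
  rewrite ler_pdivlMr//.
  have : 0 <= C * (c1 * y ^+ 3) by rewrite !mulr_ge0 ?exprn_ge0// ltW.
  have : C * K * y <= C * K * Y * ((1 + y) * (1 + y + h)).
    rewrite -[leRHS]mulrA ler_pM2l//.
    by apply: (@le_trans _ _ (Y * 1)); [lra | rewrite ler_pM2l; nra].
  by rewrite mulrBr; lra.
Qed.

(* The profile of [v] combines a geometric part, which beats the repulsive drift
   [K d h ^ 2] at scale [d ~ 1 / h], with a part of increments [~ 1 / d ^ 2], which
   exploits the cubic attraction at larger distances. *)
Lemma lyapunov_exists (K c0 c1 : R) : 0 < K -> 0 < c0 -> 0 < c1 ->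
  exists2 A : R, 0 < A & forall h : R, 0 < h <= 1 -> exists v w : nat -> R,
   [/\ forall d, 0 <= v d <= A / h ^+ 2,
       forall d, v d.+1 - v d = w d,
       forall d, 0 <= w d.+1 <= w d &
       forall d, 1 <= c0 * (w d - w d.+1) +
         (c1 * d.+1%:R ^+ 3 * h ^+ 4 - K * d.+1%:R * h ^+ 2) * w d.+1].
Proof.
move=> K0 c00 c10.
have [B [C [g [B0 C0 g0 hb]]]] := lyapunov_bound K0 c00 c10.
exists (B + C); first by rewrite addr_gt0.
move=> h /[dup] h01 /andP[h0 h1].
(* This choice makes [1 - r = g * h * r] exact. *)
pose r := (1 + g * h)^-1.
have gh0 : 0 < g * h by rewrite mulr_gt0.
have r0 : 0 < r by rewrite invr_gt0; lra.
have r1 : r <= 1 by rewrite invf_le1; lra.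
have Er : 1 - r = g * h * r by rewrite /r; field; rewrite gt_eqF//; lra.
have hd d : 0 < 1 + h * d%:R by rewrite ltr_pwDl// mulr_ge0// ltW.
have rd d : 0 < r ^+ d by rewrite exprn_gt0.
have Bgh : 0 < B * g * h by rewrite !mulr_gt0.
have Ch : 0 < C * h by rewrite mulr_gt0.
have hdd d : 0 < (1 + h * d%:R) * (1 + h * d.+1%:R) by rewrite mulr_gt0.
exists (fun d => (B * (1 - r ^+ d) + C * (1 - (1 + h * d%:R)^-1)) / h ^+ 2).
exists (fun d => (B * g * h * r ^+ d.+1
   + C * h / ((1 + h * d%:R) * (1 + h * d.+1%:R))) / h ^+ 2).
have h20 : 0 < (h ^+ 2)^-1 by rewrite invr_gt0 exprn_gt0.
split.
- move=> d; rewrite mulr_ge0 ?(ltW h20)//=; last first.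
    apply: addr_ge0; apply: mulr_ge0; rewrite ?(ltW B0) ?(ltW C0)// subr_ge0.
      by rewrite exprn_ile1// ltW.
    by rewrite invf_le1 ?hd// lerDl mulr_ge0// ltW.
  rewrite ler_pM2r// lerD// ger_pMr// gerBl ?invr_ge0 ?(ltW (hd d))//.
  by rewrite ltW.
- move=> d; rewrite -mulrBl; congr (_ / _).
  rewrite [_ ^+ d.+1 in RHS]exprS [_ ^+ d.+1 in LHS]exprS.
  have := hd d; have := hd d.+1; rewrite -natr1 => ? ?.
  rewrite (_ : B * g * h * (r * r ^+ d) = B * r ^+ d * (g * h * r)); last by ring.
  by rewrite -Er; field; rewrite !gt_eqF.
- move=> d; apply/andP; split.
    apply: mulr_ge0; last exact: ltW.
    by apply: addr_ge0; apply: mulr_ge0; rewrite ?invr_ge0; exact: ltW.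
  rewrite ler_pM2r//; apply: lerD.
    by rewrite ler_pM2l// [leLHS]exprS ler_piMl// ltW.
  rewrite ler_pM2l// lef_pV2 ?posrE// mulrC.
  by rewrite ler_pM2l// lerD2l ler_pM2l// ler_nat ltnW.
- move=> d; pose y := h * d.+1%:R.
  have y0 : 0 <= y by rewrite mulr_ge0// ltW.
  have hr : expR (- (g * (y + 1))) <= r ^+ d.+2.
    apply: (@le_trans _ _ (expR (- (g * h)) ^+ d.+2)).
      rewrite -expRM_natl ler_expR -natr1 mulrN lerN2 /y.
      by rewrite (_ : _ * (g * h) = g * (h * d.+1%:R + h)); [rewrite ler_pM2l//; lra|ring].
    rewrite lerXn2r ?nnegrE ?expR_ge0 ?(ltW r0)// expRN lef_pV2 ?posrE ?expR_gt0//; last lra.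
    exact: expR_ge1Dx.
  apply: le_trans (hb h y _ h01 y0 hr) _.
  rewrite -mulrBl.
  have e2 : 1 + h * d.+2%:R = 1 + y + h by rewrite -natr1 /y; ring.
  rewrite !e2 -/y.
  have e1 : c1 * d.+1%:R ^+ 3 * h ^+ 4 - K * d.+1%:R * h ^+ 2 = h * (c1 * y ^+ 3 - K * y).
    by rewrite /y; ring.
  rewrite e1.
  have e3 : B * g * h * r ^+ d.+1 - B * g * h * r ^+ d.+2 =
     B * g * h * (g * h) * r ^+ d.+2.
    rewrite [r ^+ d.+2]exprS.
    rewrite (_ : B * g * h * (g * h) * (r * r ^+ d.+1) = B * g * h * (g * h * r) * r ^+ d.+1); last by ring.
    by rewrite -Er; ring.
  have D0 : 0 < (1 + y) * (1 + y + h) by nra.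
  have hy : 0 < 1 + h * d%:R by [].
  have ed : 1 + h * d%:R = 1 + y - h by rewrite /y -natr1; ring.
  rewrite ed in hy *.
  (* The rational part is concave too; its second difference only helps and is discarded below. *)
  have e4 : 0 <= C * h / ((1 + y - h) * (1 + y)) - C * h / ((1 + y) * (1 + y + h)).
    rewrite subr_ge0 ler_pM2l ?mulr_gt0// lef_pV2 ?posrE//; last by nra.
    by nra.
  rewrite [X in c0 * (X / _)](_ : _ = B * g * h * (g * h) * r ^+ d.+2 +
     (C * h / ((1 + y - h) * (1 + y)) - C * h / ((1 + y) * (1 + y + h)))); last first.
    by rewrite -e3; ring.
  move: e4; set X := _ - C * h / _ => X0.
  rewrite -subr_ge0.
  suff -> : c0 * ((B * g * h * (g * h) * r ^+ d.+2 + X) / h ^+ 2) +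
    h * (c1 * y ^+ 3 - K * y) *
    ((B * g * h * r ^+ d.+2 + C * h / ((1 + y) * (1 + y + h))) / h ^+ 2) -
    (B * g * r ^+ d.+2 * (c0 * g + c1 * y ^+ 3 - K * y) +
     C * (c1 * y ^+ 3 - K * y) / ((1 + y) * (1 + y + h))) = c0 * X / h ^+ 2.
    by rewrite mulr_ge0 ?(ltW h20)// mulr_ge0 // ltW.
  by field; rewrite !gt_eqF//; lra.
Qed.
End Lyapunov.

(** * Coupling of birth-death chains *)

Section BirthDeath.
Variable R : realType.
Variables (n : nat) (p q : nat -> R).

Definition bd_step (g : nat -> R) (k : nat) : R :=
  g k + p k * (g k.+1 - g k) + q k * (g k.-1 - g k).

(* A coupling of the steps from [k < l]: the up-move from [k] and the down-move from
   [l] are disjoint, so that the two chains cannot cross without meeting, while the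
   down-move from [k] is run jointly with the up-move from [l] as far as possible. *)
Definition bd_couple (F : nat -> nat -> R) (k l : nat) : R :=
  let e := Num.min (q k) (p l) in
  p k * F k.+1 l + q l * F k l.-1 + e * F k.-1 l.+1 + (q k - e) * F k.-1 l +
  (p l - e) * F k l.+1 + (1 - p k - q l - q k - p l + e) * F k l.

(** The probability that the coupled pair has not met within [s] steps. Pairs with [k >= l] count as
    met. *)
Fixpoint bd_uncoupled (s : nat) (k l : nat) : R :=
  if s is s'.+1 then (if (k < l)%N then bd_couple (bd_uncoupled s') k l else 0)
  else (k < l)%N%:R.

Hypothesis p_bnd : forall k, (k <= n)%N -> 0 <= p k <= 3 / 10.
Hypothesis q_bnd : forall k, (k <= n)%N -> 0 <= q k <= 3 / 10.
Hypothesis q0 : q 0%N = 0.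
Hypothesis pn : p n = 0.

Lemma bd_couple_le (F G : nat -> nat -> R) k l :
  (forall k' l', (k' <= l' <= n)%N -> F k' l' <= G k' l') -> (k < l <= n)%N ->
  bd_couple F k l <= bd_couple G k l.
Proof.
move=> FG /andP[kl ln]; rewrite /bd_couple.
have kn : (k <= n)%N by lia.
have i1 : (k < l <= n)%N by lia.
have i2 : (k <= l.-1 <= n)%N by lia.
have i3 : (k.-1 <= l <= n)%N by lia.
have i4 : (k <= l <= n)%N by lia.
have i5 : (l < n)%N -> (k <= l.+1 <= n)%N by lia.
have i6 : (l < n)%N -> (k.-1 <= l.+1 <= n)%N by lia.
have /andP[pk0 pk1] := p_bnd kn; have /andP[qk0 qk1] := q_bnd kn.
have /andP[pl0 pl1] := p_bnd ln; have /andP[ql0 ql1] := q_bnd ln.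
set e := Num.min _ _.
have e0 : 0 <= e by rewrite /e le_min qk0.
have eq : e <= q k by rewrite /e ge_min lexx.
have ep : e <= p l by rewrite /e ge_min lexx orbT.
(* The holding weight is [1 - p k - q l - max (q k) (p l)]; three rates of at most 3/10 fit. *)
have m : 0 <= 1 - p k - q l - q k - p l + e.
  by rewrite /e; case: (leP (q k) (p l)); lra.
have T (c : R) k' l' : 0 <= c -> c = 0 \/ (k' <= l' <= n)%N -> c * F k' l' <= c * G k' l'.
  by move=> c_ge0 [->|/FG]; [rewrite !mul0r|exact: ler_wpM2l].
(* At [l = n] the weight of every up-move from [l] vanishes, which covers the pairs outside the
   range of [FG]. *)
have lT (c : R) : (p l = 0 -> c = 0) -> c = 0 \/ (l < n)%N.
  move=> pc; case: (ltnP l n) => [|nl]; [by right|left; apply: pc].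
  by rewrite (_ : l = n)//; apply/eqP; rewrite eqn_leq ln.
apply: lerD; last by apply: T => //; right.
apply: lerD; last first.
  by apply: T; [rewrite subr_ge0|case: (@lT (p l - e)) => [?|?|/i5]; [lra|left|right]].
apply: lerD; last by apply: T; [rewrite subr_ge0|right].
apply: lerD; last by apply: T => //; case: (@lT e) => [?|?|/i6]; [lra|left|right].
by apply: lerD; apply: T => //; right.
Qed.

(** This expresses that both marginals of the coupling are the original chain. *)
Lemma bd_step_diff (g : nat -> R) k l :
  bd_step g k - bd_step g l = bd_couple (fun k l => g k - g l) k l.
Proof. by rewrite /bd_step /bd_couple; set e := Num.min _ _; ring. Qed.

Lemma bd_coupleN (F : nat -> nat -> R) k l :
  - bd_couple F k l = bd_couple (fun k l => - F k l) k l.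
Proof. by rewrite /bd_couple; set e := Num.min _ _; ring. Qed.

Lemma bd_coupleZ c (F : nat -> nat -> R) k l :
  c * bd_couple F k l = bd_couple (fun k l => c * F k l) k l.
Proof. by rewrite /bd_couple; set e := Num.min _ _; ring. Qed.

Lemma bd_couple_sum s (F : nat -> nat -> nat -> R) k l :
  \sum_(i < s) bd_couple (F i) k l = bd_couple (fun k l => \sum_(i < s) F i k l) k l.
Proof.
elim: s => [|s IH]; first by rewrite /bd_couple !big_ord0 !mulr0 !addr0.
rewrite big_ord_recr/= IH /bd_couple !big_ord_recr/=.
by set e := Num.min _ _; ring.
Qed.

Lemma bd_diff_le (g : nat -> R) s k l : (forall k, `|g k| <= 1) ->
  (k <= l <= n)%N ->
  `|iter s bd_step g k - iter s bd_step g l| <= 2 * bd_uncoupled s k l.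
Proof.
move=> g1; elim: s k l => [|s IH] k l kln /=.
  case: ltnP => [_|lk]; last by rewrite (_ : k = l) ?subrr ?normr0 ?mulr0//; lia.
  rewrite mulr1; apply: le_trans (ler_normB _ _) _.
  by have := g1 k; have := g1 l; lra.
case: ltnP => [kl|lk]; last by rewrite (_ : k = l) ?subrr ?normr0 ?mulr0//; lia.
rewrite bd_step_diff bd_coupleZ ler_norml bd_coupleN; apply/andP; split.
  by apply: bd_couple_le; [move=> k' l' /IH; rewrite ler_norml => /andP[]|lia].
by apply: bd_couple_le; [move=> k' l' /IH; rewrite ler_norml => /andP[]|lia].
Qed.

Lemma bd_couple1 k l : bd_couple (fun _ _ => 1) k l = 1.
Proof. by rewrite /bd_couple; set e := Num.min _ _; ring. Qed.

Lemma bd_uncoupled_decr s k l : (k <= l <= n)%N ->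
  bd_uncoupled s.+1 k l <= bd_uncoupled s k l.
Proof.
elim: s k l => [|s IH] k l kln /=; case: ltnP => // kl.
  rewrite -[leRHS](bd_couple1 k l); apply: bd_couple_le; last lia.
  by move=> k' l' _ /=; rewrite lern1; case: (_ < _)%N.
by apply: bd_couple_le; [exact: IH|lia].
Qed.

Lemma bd_uncoupled_le s t k l : (k <= l <= n)%N -> (s <= t)%N ->
  bd_uncoupled t k l <= bd_uncoupled s k l.
Proof.
move=> kln /subnK <-; elim: (t - s)%N => // m IH.
by rewrite addSn; apply: le_trans IH; exact: bd_uncoupled_decr.
Qed.

(** * Meeting times from supersolutions *)

Section Supersolution.
Variable v : nat -> R.
Hypothesis v_ge0 : forall d, 0 <= v d.
Hypothesis v_super : forall k l, (k < l <= n)%N ->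
  bd_couple (fun k l => v (l - k)%N) k l <= v (l - k)%N - 1.

(** The sum is the mean meeting time truncated at [s]; a nonnegative function that loses at least 1
    per step in mean dominates it. *)
Lemma bd_uncoupled_sum_le s k l : (k <= l <= n)%N ->
  \sum_(i < s) bd_uncoupled i k l <= v (l - k)%N.
Proof.
elim: s k l => [|s IH] k l kln; first by rewrite big_ord0.
rewrite big_ord_recl /=; case: ltnP => kl; last by rewrite add0r big1.
rewrite bd_couple_sum -lerBrDl.
apply: le_trans (@v_super k l _); last by lia.
by apply: bd_couple_le; [exact: IH|lia].
Qed.

(* The probability of not having met is nonincreasing in time, so it is at most
   its average over [s] steps. *)
Lemma bd_uncoupled_mean s k l : (k <= l <= n)%N ->
  s%:R * bd_uncoupled s k l <= v (l - k)%N.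
Proof.
move=> kln; apply: le_trans (bd_uncoupled_sum_le s kln).
rewrite mulr_natl -[s in _ *+ s](card_ord s) -sumr_const.
by apply: ler_sum => i _; apply: bd_uncoupled_le => //; exact: ltnW.
Qed.

End Supersolution.

Section Mixing.
Variables K c0 c1 h : R.
Hypothesis pq_ge : forall k l, (k < l <= n)%N -> c0 <= p k + q l.
Hypothesis drift_le : forall k l, (k < l <= n)%N ->
  (p l - q l) - (p k - q k) <=
   K * (l - k)%:R * h ^+ 2 - c1 * (l - k)%:R ^+ 3 * h ^+ 4.
Variables v w : nat -> R.
Hypothesis v_w : forall d, v d.+1 - v d = w d.
Hypothesis w_decr : forall d, 0 <= w d.+1 <= w d.
Hypothesis w_lyapunov : forall d, 1 <= c0 * (w d - w d.+1) +
  (c1 * d.+1%:R ^+ 3 * h ^+ 4 - K * d.+1%:R * h ^+ 2) * w d.+1.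

(** The joint move adds [w d.+1 + w d.+2], by concavity at most twice [w d.+1], so it costs no more
    than two separate moves. The mean increment is therefore at most the drift difference times
    [w d.+1], minus [(p k + q l) * (w d - w d.+1)]. *)
Lemma bd_couple_super k l : (k < l <= n)%N ->
  bd_couple (fun k l => v (l - k)%N) k l <= v (l - k)%N - 1.
Proof.
move=> /[dup] kln /andP[kl ln]; rewrite /bd_couple.
have kn : (k <= n)%N by lia.
have [d dE] : exists d, (l - k = d.+1)%N by exists (l - k).-1; lia.
have -> : (l - k.+1 = d)%N by lia.
have -> : (l.-1 - k = d)%N by lia.
have -> : (l.+1 - k = d.+2)%N by lia.
have d2 : (0 < k)%N -> (l - k.-1 = d.+2)%N by lia.
have d3 : (0 < k)%N -> (l.+1 - k.-1 = d.+3)%N by lia.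
rewrite dE.
have /andP[pk0 pk1] := p_bnd kn; have /andP[qk0 qk1] := q_bnd kn.
have /andP[pl0 pl1] := p_bnd ln; have /andP[ql0 ql1] := q_bnd ln.
set e := Num.min _ _.
have e0 : 0 <= e by rewrite /e le_min qk0.
have eq : e <= q k by rewrite /e ge_min lexx.
(* [k.-1] is truncated at [k = 0], where [q 0 = 0] removes the move. *)
have E1 : (q k - e) * v (l - k.-1)%N = (q k - e) * v d.+2.
  have [k0|k0] := posnP k; last by rewrite d2.
  by rewrite (_ : q k - e = 0) ?mul0r//; move: eq; rewrite k0 q0; lra.
have E2 : e * v (l.+1 - k.-1)%N = e * v d.+3.
  have [k0|k0] := posnP k; last by rewrite d3.
  by rewrite (_ : e = 0) ?mul0r//; move: eq; rewrite k0 q0; lra.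
rewrite E1 E2.
have := pq_ge kln; have := drift_le kln; rewrite dE.
have := w_lyapunov d; have /andP[w1 w2] := w_decr d.
have /andP[w3 w4] := w_decr d.+1.
have -> : v d = v d.+1 - w d by rewrite -v_w; ring.
have -> : v d.+3 = v d.+1 + w d.+1 + w d.+2 by rewrite -!v_w; ring.
have -> : v d.+2 = v d.+1 + w d.+1 by rewrite -!v_w; ring.
set x := K * _ * _; set y := c1 * _ * _.
move=> L D C.
have h1 : (p l - q l - (p k - q k)) * w d.+1 <= (x - y) * w d.+1 by rewrite ler_wpM2r.
have h2 : c0 * (w d - w d.+1) <= (p k + q l) * (w d - w d.+1).
  by rewrite ler_wpM2r// subr_ge0.
have h3 : e * w d.+2 <= e * w d.+1 by rewrite ler_wpM2l.
have : (1 - p k - q l - q k - p l + e) * v d.+1 + (p k + q l + q k + p l - e) * v d.+1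
   = v d.+1 by ring.
by lra.
Qed.

End Mixing.
End BirthDeath.

(** [A] is fixed before the chain and [h], so the bound is uniform in [n] and in the rates. *)
Lemma bd_mixing (R : realType) (K c0 c1 : R) : 0 < K -> 0 < c0 -> 0 < c1 ->
  exists2 A : R, 0 < A &
  forall (n : nat) (p q : nat -> R) (h : R), 0 < h <= 1 ->
   (forall k, (k <= n)%N -> 0 <= p k <= 3 / 10) ->
   (forall k, (k <= n)%N -> 0 <= q k <= 3 / 10) ->
   q 0%N = 0 -> p n = 0 ->
   (forall k l, (k < l <= n)%N -> c0 <= p k + q l) ->
   (forall k l, (k < l <= n)%N -> (p l - q l) - (p k - q k) <=
      K * (l - k)%:R * h ^+ 2 - c1 * (l - k)%:R ^+ 3 * h ^+ 4) ->
   forall (g : nat -> R) (s k l : nat), (forall k, `|g k| <= 1) ->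
    (k <= n)%N -> (l <= n)%N ->
    s%:R * `|iter s (bd_step p q) g k - iter s (bd_step p q) g l| <= A / h ^+ 2.
Proof.
move=> K0 c00 c10; have [A A0 hA] := lyapunov_exists K0 c00 c10.
exists (2 * A); first by rewrite mulr_gt0.
move=> n p q h h01 pb qb q0 pn pq dr g s.
have [v [w [vA vw wd wl]]] := hA h h01.
move=> k0 l0 g1.
have key k l : (k <= l <= n)%N ->
    s%:R * `|iter s (bd_step p q) g k - iter s (bd_step p q) g l| <= 2 * A / h ^+ 2.
  move=> kln.
  have := bd_diff_le pb qb pn s g1 kln.
  have sup := bd_couple_super pb qb q0 pq dr vw wd wl.
  have v0 d : 0 <= v d by have /andP[] := vA d.
  have := bd_uncoupled_mean pb qb pn v0 sup s kln.
  have /andP[_] := vA (l - k)%N.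
  rewrite -mulrA; set X := A / _; set u := bd_uncoupled _ _ _ _ _; set y := `|_|.
  move=> vX uv yu; apply: le_trans (_ : s%:R * (2 * u) <= _).
    by rewrite ler_wpM2l.
  by rewrite mulrCA ler_pM2l// (le_trans uv).
move=> kn ln; have [kl|lk] := leqP k0 l0; first by apply: key; rewrite kl.
by rewrite distrC; apply: key; rewrite ltnW.
Qed.

(** * Glauber dynamics *)

Section Glauber.
Variables (R : realType) (n : nat) (beta : R).
Local Notation spin := (@spin R).
Local Notation mu := (@cw_mu R n beta).
Implicit Types (s u : config n) (v x y : 'I_n) (b : bool) (f g : config n -> R).

Definition mag s : R := \sum_x spin (s x).

Definition plus s : nat := #|[pred x | s x]|.

Lemma spin_sqr b : spin b ^+ 2 = 1.
Proof. by case: b; rewrite /Defs.spin ?expr1n// sqrrN expr1n. Qed.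

Lemma cw_weight_mag s :
  cw_weight beta s = expR (beta / n%:R / 2 * (mag s ^+ 2 - n%:R)).
Proof.
rewrite /cw_weight; congr expR; rewrite -[RHS]mulrA; congr (_ * _).
set P := \sum_x _.
suff -> : mag s ^+ 2 = n%:R + 2 * P by field.
have E : mag s ^+ 2 = \sum_x \sum_y spin (s x) * spin (s y).
  by rewrite expr2 /mag mulr_suml; apply: eq_bigr => x _; rewrite mulr_sumr.
rewrite E (eq_bigr (fun x => 1 + \sum_(y : 'I_n | (x < y)%N) spin (s x) * spin (s y) +
   \sum_(y : 'I_n | (y < x)%N) spin (s x) * spin (s y))); last first.
  move=> x _; rewrite (bigD1 x)//= -expr2 spin_sqr -addrA; congr (_ + _).
  rewrite (bigID (fun y : 'I_n => (x < y)%N))/=; congr (_ + _); apply: eq_bigl => y.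
    by rewrite -(inj_eq val_inj)/= neq_ltn; case: ltngtP.
  by rewrite -(inj_eq val_inj)/= neq_ltn; case: ltngtP.
rewrite !big_split/= sumr_const card_ord -/P.
rewrite (exchange_big_dep xpredT)//= (_ : \sum_j _ = P); last first.
  by apply: eq_bigr => x _; apply: eq_bigr => y _; rewrite mulrC.
by ring.
Qed.

Lemma upd_eq s v b : upd s v b v = b.
Proof. by rewrite ffunE eqxx. Qed.

Lemma upd_neq s v b x : x != v -> upd s v b x = s x.
Proof. by rewrite ffunE => /negbTE ->. Qed.

Lemma mag_upd s v b : mag (upd s v b) = mag s - spin (s v) + spin b.
Proof.
rewrite /mag (bigD1 v)//= [\sum_x spin (s x)](bigD1 v)//= upd_eq.
rewrite (eq_bigr (fun x => spin (s x))); first by ring.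
by move=> x xv; rewrite upd_neq.
Qed.

(** The effective field at [v], generated by the other spins only. *)
Definition lfield s v : R := beta * (mag s - spin (s v)) / n%:R.

Lemma cw_part_gt0 : 0 < \sum_(s : config n) cw_weight beta s.
Proof.
rewrite (bigD1 [ffun _ => true])//= ltr_pwDl ?expR_gt0//.
by apply: sumr_ge0 => s _; exact: expR_ge0.
Qed.

Lemma cw_mu_gt0 s : 0 < mu s.
Proof. by rewrite divr_gt0 ?expR_gt0 ?cw_part_gt0. Qed.

Lemma cw_mu_sum1 : \sum_s mu s = 1.
Proof. by rewrite -mulr_suml mulfV// gt_eqF// cw_part_gt0. Qed.

(** Both weights share the factor [E]; what remains is [e / (e + e^-1)] or its complement, with [e]
    the exponential of the field. *)
Lemma cw_mu_upd s v b :
  mu (upd s v b) / (mu (upd s v true) + mu (upd s v false)) =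
  (1 + spin b * th (lfield s v)) / 2.
Proof.
rewrite /cw_mu -mulrDl invfM invrK mulrACA mulVf ?mulr1; last first.
  by rewrite gt_eqF// cw_part_gt0.
rewrite !cw_weight_mag !mag_upd.
set h := mag s - spin (s v).
set E := expR (beta / n%:R / 2 * (h ^+ 2 + 1 - n%:R)).
set e := expR (lfield s v).
have H b' : expR (beta / n%:R / 2 * ((h + spin b') ^+ 2 - n%:R)) =
    E * (if b' then e else e^-1).
  have -> : (h + spin b') ^+ 2 = h ^+ 2 + 1 + spin b' * (2 * h).
    by rewrite sqrrD spin_sqr mulr2n; ring.
  have -> : beta / n%:R / 2 * (h ^+ 2 + 1 + spin b' * (2 * h) - n%:R) =
    beta / n%:R / 2 * (h ^+ 2 + 1 - n%:R) + spin b' * lfield s v.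
    by rewrite /lfield -/h; move: (n%:R^-1) => i; field.
  rewrite expRD; congr (_ * _); case: b'; first by rewrite mul1r.
  by rewrite mulN1r expRN.
rewrite !H /= thE (_ : expR (2 * _) = e ^+ 2); last by rewrite -(expRM_natl 2).
have e0 : 0 < e by exact: expR_gt0.
have E0 : 0 < E by exact: expR_gt0.
have n0 : e ^+ 2 + 1 != 0 by rewrite gt_eqF// addr_gt0// exprn_gt0.
have n2 : E * e * e + E != 0 by rewrite gt_eqF// addr_gt0// !mulr_gt0.
by case: b => /=; field; rewrite n0 n2 gt_eqF.
Qed.

Definition glauber_op f s : R := \sum_u glauber beta s u * f u.

Lemma glauber_opE f s : glauber_op f s =
  n%:R^-1 * \sum_v ((1 + th (lfield s v)) / 2 * f (upd s v true) +
                    (1 - th (lfield s v)) / 2 * f (upd s v false)).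
Proof.
rewrite /glauber_op (eq_bigr (fun u => n%:R^-1 * \sum_v
   (if [forall w, (w != v) ==> (u w == s w)] then
     mu u / (mu (upd s v true) + mu (upd s v false)) * f u else 0))); last first.
  move=> u _; rewrite /glauber -mulrA mulr_suml; congr (_ * _).
  by apply: eq_bigr => v _; case: ifP => //; rewrite mul0r.
rewrite -mulr_sumr exchange_big /=; congr (_ * _); apply: eq_bigr => v _.
rewrite -big_mkcond /= (bigD1 (upd s v true))/=; last first.
  by apply/forallP => w; apply/implyP => wv; rewrite upd_neq.
rewrite (bigD1 (upd s v false))/=; last first.
  apply/andP; split; first by apply/forallP => w; apply/implyP => wv; rewrite upd_neq.
  by apply/eqP => /ffunP/(_ v); rewrite !upd_eq.
rewrite big1 ?addr0; last first.
  move=> u /andP[/andP[/forallP h u1] u2]; exfalso.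
  have : u = upd s v (u v).
    apply/ffunP => w; rewrite ffunE; case: eqP => [->//|/eqP wv].
    by have /implyP/(_ wv)/eqP := h w.
  by case: (u v) => uE; [move: u1|move: u2]; rewrite -uE eqxx.
by rewrite !cw_mu_upd /= mul1r mulN1r.
Qed.

Lemma glauber_reversible s u : mu s * glauber beta s u = mu u * glauber beta u s.
Proof.
rewrite /glauber mulrCA [RHS]mulrCA; congr (_ * _).
rewrite !mulr_sumr; apply: eq_bigr => v _.
rewrite (_ : [forall w, (w != v) ==> (s w == u w)] =
             [forall w, (w != v) ==> (u w == s w)]); last first.
  by apply: eq_forallb => w; rewrite (eq_sym (s w)).
case: ifP => [/forallP h|_]; last by rewrite !mulr0.
have hE b : upd u v b = upd s v b.
  apply/ffunP => w; rewrite !ffunE; case: eqP => // /eqP wv.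
  by have /implyP/(_ wv)/eqP := h w.
by rewrite !hE mulrCA.
Qed.

Lemma glauber_op_const (c : R) s : (0 < n)%N -> glauber_op (fun=> c) s = c.
Proof.
move=> n0; rewrite glauber_opE (eq_bigr (fun=> c)); last by move=> v _; field.
by rewrite sumr_const card_ord -[c *+ n]mulr_natl mulKf// pnatr_eq0 -lt0n.
Qed.

Lemma glauber_sum1 s : (0 < n)%N -> \sum_u glauber beta s u = 1.
Proof.
move=> n0; rewrite -[RHS](glauber_op_const 1 s n0).
by apply: eq_bigr => u _; rewrite mulr1.
Qed.

Lemma glauber_ge0 s u : 0 <= glauber beta s u.
Proof.
rewrite mulr_ge0 ?invr_ge0// sumr_ge0// => v _; case: ifP => // _.
by rewrite divr_ge0 ?addr_ge0// ltW// cw_mu_gt0.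
Qed.

Lemma glauber_op_mu f : (0 < n)%N -> \sum_s mu s * glauber_op f s = \sum_s mu s * f s.
Proof.
move=> n0; rewrite /glauber_op.
under eq_bigr do rewrite mulr_sumr.
rewrite exchange_big/=; apply: eq_bigr => u _.
under eq_bigr do rewrite mulrA glauber_reversible -mulrA [_ * f u]mulrC.
by rewrite -mulr_sumr -mulr_sumr glauber_sum1// mulr1.
Qed.

Lemma glauber_op_norm f (M : R) : (0 < n)%N -> (forall s, `|f s| <= M) ->
  forall s, `|glauber_op f s| <= M.
Proof.
move=> n0 fM s; apply: le_trans (ler_norm_sum _ _ _) _.
rewrite -[leRHS](glauber_op_const M s n0); apply: ler_sum => u _.
by rewrite normrM ger0_norm ?glauber_ge0// ler_wpM2l ?glauber_ge0.
Qed.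

Lemma glauber_opB f g s :
  glauber_op (fun s => f s - g s) s = glauber_op f s - glauber_op g s.
Proof.
by rewrite /glauber_op -sumrB; apply: eq_bigr => u _; rewrite mulrBr.
Qed.

Lemma glauber_tS t s u :
  glauber_t beta t.+1 s u = \sum_z glauber beta s z * glauber_t beta t z u.
Proof.
rewrite /glauber_t exprS mxE (reindex (@enum_rank (config n)))/=; last first.
  by apply: onW_bij; exact: enum_rank_bij.
by apply: eq_bigr => z _; rewrite mxE !enum_rankK.
Qed.

Lemma glauber_t0 s u : glauber_t beta 0 s u = (s == u)%:R.
Proof. by rewrite /glauber_t expr0 mxE (inj_eq enum_rank_inj). Qed.

Lemma glauber_tE t f s : \sum_u glauber_t beta t s u * f u = iter t glauber_op f s.
Proof.
elim: t s => [|t IH] s /=.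
  rewrite (bigD1 s)//= glauber_t0 eqxx mul1r big1 ?addr0// => u us.
  by rewrite glauber_t0 eq_sym (negbTE us) mul0r.
rewrite [RHS]/glauber_op; under [RHS]eq_bigr do rewrite -IH mulr_sumr.
rewrite exchange_big/=; apply: eq_bigr => u _.
by rewrite glauber_tS mulr_suml; apply: eq_bigr => z _; rewrite mulrA.
Qed.

End Glauber.

(** * Reduction to the magnetization chain *)

Section Swap.
Variables (R : realType) (n : nat) (beta : R).
Implicit Types (s u : config n) (v x y : 'I_n) (b : bool) (f g G : config n -> R).
Local Notation op := (@glauber_op R n beta).
Local Notation lfield := (@lfield R n beta).

Definition swap x y s : config n := [ffun w => s (tperm x y w)].

Lemma swapK x y : involutive (swap x y).
Proof. by move=> s; apply/ffunP => w; rewrite !ffunE tpermK. Qed.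

Lemma mag_swap x y s : mag R (swap x y s) = mag R s.
Proof.
rewrite /mag [RHS](reindex (tperm x y))/=; last first.
  by apply: onW_bij; exists (tperm x y); exact: tpermK.
by apply: eq_bigr => w _; rewrite ffunE.
Qed.

Lemma upd_swap x y s v b : upd (swap x y s) v b = swap x y (upd s (tperm x y v) b).
Proof.
by apply/ffunP => w; rewrite !ffunE (can2_eq (@tpermK _ x y) (@tpermK _ x y)) tpermK.
Qed.

Lemma lfield_swap x y s v : lfield (swap x y s) v = lfield s (tperm x y v).
Proof. by rewrite /lfield mag_swap ffunE. Qed.

Lemma op_swap x y f s : op f (swap x y s) = op (f \o swap x y) s.
Proof.
rewrite !glauber_opE; congr (_ * _); rewrite [RHS](reindex (tperm x y))/=; last first.
  by apply: onW_bij; exists (tperm x y); exact: tpermK.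
by apply: eq_bigr => v _; rewrite lfield_swap !upd_swap.
Qed.

Lemma iter_op_swap t x y f s : iter t op f (swap x y s) = iter t op (f \o swap x y) s.
Proof.
elim: t s => //= t IH s; rewrite op_swap.
by congr (op _ s); apply/funext => u /=; exact: IH.
Qed.

Lemma iter_opB t f g s :
  iter t op (fun s => f s - g s) s = iter t op f s - iter t op g s.
Proof.
elim: t s => //= t IH s; rewrite -glauber_opB.
by congr (op _ s); apply/funext => u /=; exact: IH.
Qed.

Lemma iter_op_norm t f (M : R) : (0 < n)%N -> (forall s, `|f s| <= M) ->
  forall s, `|iter t op f s| <= M.
Proof. by move=> n0 fM; elim: t => //= t IH; exact: glauber_op_norm. Qed.

Variable c : R.
Hypothesis rate_ge : forall s v b, c <= (1 + spin R b * th (lfield s v)) / 2.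

(* An antisymmetric function vanishes where the two spins agree; resampling the spin
   at [x] makes them agree with probability at least [c]. *)
Lemma op_antisym x y G (M : R) : x != y -> (forall s, G (swap x y s) = - G s) ->
  (forall s, `|G s| <= M) -> forall s, `|op G s| <= (1 - c / n%:R) * M.
Proof.
move=> xy Ga GM s.
have n0 : (0 < n)%N by apply: leq_ltn_trans (ltn_ord x).
have nR : 0 < n%:R :> R by rewrite ltr0n.
have M0 : 0 <= M by apply: le_trans (GM s).
have G0 u : u x = u y -> G u = 0.
  move=> uxy; have : G u = - G u.
    rewrite -Ga; congr G; apply/ffunP => w; rewrite ffunE.
    by case: tpermP => // ->.
  by move=> h; lra.
pose T v := (1 + th (lfield s v)) / 2 * G (upd s v true) +
            (1 - th (lfield s v)) / 2 * G (upd s v false).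
have TM v : `|T v| <= M.
  have := th_lt1 (lfield s v); have := th_gtN1 (lfield s v).
  have := GM (upd s v true); have := GM (upd s v false).
  rewrite !ler_norml /T; move: (G _) (G _) (th _) => a b t.
  move=> /andP[? ?] /andP[? ?] ? ?; apply/andP; split; nra.
have Tx : `|T x| <= (1 - c) * M.
  have := rate_ge s x true; have := rate_ge s x false.
  have := GM (upd s x true); have := GM (upd s x false).
  have := th_lt1 (lfield s x); have := th_gtN1 (lfield s x).
  rewrite /T /spin mul1r mulN1r !ler_norml.
  have : G (upd s x (s y)) = 0 by apply: G0; rewrite upd_eq upd_neq// eq_sym.
  case: (s y) => ->; move: (G _) (th _) => a t;
  move=> ? ? /andP[? ?] /andP[? ?] ? ?; apply/andP; split; nra.
rewrite glauber_opE normrM ger0_norm ?invr_ge0 ?(ltW nR)// ler_pdivrMl//.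
rewrite (eq_bigr T)// [leRHS](_ : _ = M *+ n - c * M); last first.
  by rewrite -[M *+ n]mulr_natl; field; rewrite gt_eqF.
rewrite (bigD1 x)//=; apply: le_trans (ler_normD _ _) _.
have -> : M *+ n - c * M = (1 - c) * M + M *+ n.-1.
  by rewrite -{1}(prednK n0) mulrS; ring.
apply: lerD => //; apply: le_trans (ler_norm_sum _ _ _) _.
apply: (@le_trans _ _ (\sum_(i < n | i != x) M)); first exact: ler_sum.
by rewrite sumr_const cardC1 card_ord.
Qed.

(** The functional form of coupling two exchanged configurations. The dynamics commutes with
    exchanges, so the difference is an iterate of the antisymmetric function [f \o swap x y - f],
    bounded by 2 and contracted at each step. *)
Lemma iter_op_antisym t x y f s : x != y -> (forall s, `|f s| <= 1) ->
  `|iter t op f (swap x y s) - iter t op f s| <= 2 * (1 - c / n%:R) ^+ t.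
Proof.
move=> xy f1; rewrite iter_op_swap -iter_opB.
pose G0 u := (f \o swap x y) u - f u.
have Ga t' u : iter t' op G0 (swap x y u) = - iter t' op G0 u.
  rewrite iter_op_swap !iter_opB opprB; congr (_ - _); congr (iter t' op _ u).
  by apply/funext => z /=; rewrite swapK.
rewrite -/G0 mulrC; elim: t s => [|t IH] s.
  rewrite expr0 mul1r /G0 /=; apply: le_trans (ler_normB _ _) _.
  by have := f1 (swap x y s); have := f1 s; lra.
by rewrite /= exprS -mulrA; apply: (op_antisym xy).
Qed.

(** Exchanging a vertex where only [s] is plus with one where only [u] is plus removes two
    disagreements, so at most [n] exchanges, each of cost [e], lead from [s] to [u]. *)
Lemma plus_eq_diff f (e : R) : 0 <= e ->
  (forall x y s, x != y -> `|f (swap x y s) - f s| <= e) ->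
  forall s u, plus s = plus u -> `|f s - f u| <= n%:R * e.
Proof.
move=> e0 fe s u su.
suff [m mn] : exists2 m, (m <= n)%N & `|f s - f u| <= m%:R * e.
  by move/le_trans; apply; rewrite ler_wpM2r// ler_nat.
exists #|[pred x | s x && ~~ u x]|; first by rewrite -[leqRHS](card_ord n) max_card.
have [m] := ubnP #|[pred x | s x && ~~ u x]|.
elim: m s su => // m IH s su.
(* Equal plus counts make the two kinds of disagreement equally frequent, which provides the partner
   vertex for an exchange. *)
have E : #|[pred x | s x && ~~ u x]| = #|[pred x | ~~ s x && u x]|.
  have := cardID [pred x | u x] [pred x | s x].
  have := cardID [pred x | s x] [pred x | u x].
  rewrite -/(plus s) -/(plus u) su => <- /eqP.
  rewrite (eq_card (_ : [predI [pred x | u x] & [pred x | s x]] =i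
                        [predI [pred x | s x] & [pred x | u x]])); last first.
    by move=> z; rewrite !inE andbC.
  rewrite eqn_add2l => /eqP h.
  rewrite (eq_card (_ : _ =i [predD [pred x | s x] & [pred x | u x]])); last first.
    by move=> z; rewrite !inE andbC.
  by rewrite h; apply: eq_card => z; rewrite !inE.
have [/eqP c0 _|] := posnP #|[pred x | s x && ~~ u x]|.
  have -> : s = u.
    apply/ffunP => z; move/eqP/card0_eq/(_ z): (c0); move/eqP: (c0); rewrite E.
    by move=> /card0_eq/(_ z); rewrite !inE; case: (s z); case: (u z).
  by rewrite subrr normr0 mulr_ge0.
move=> /[dup]; rewrite {1}E => /card_gt0P[y]; rewrite inE => /andP[sy uy].
move=> /card_gt0P[x]; rewrite inE => /andP[sx ux] hm.
have xy : x != y by apply/eqP => xy; move: sx; rewrite xy (negbTE sy).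
have pS : plus (swap x y s) = plus s.
  rewrite /plus -!sum1_card [RHS](reindex_inj (@perm_inj _ (tperm x y)))/=.
  by apply: eq_bigl => w; rewrite !inE ffunE.
have cS : #|[pred z | s z && ~~ u z]| = #|[pred z | swap x y s z && ~~ u z]|.+1.
  rewrite (cardD1 x) inE sx ux add1n; congr _.+1; apply: eq_card => z.
  rewrite !inE ffunE; case: tpermP => [->|->|/eqP zx _].
  - by rewrite eqxx (negbTE sy).
  - by rewrite (negbTE sy) uy !andbF.
  - by rewrite zx.
have := IH (swap x y s); rewrite pS => /(_ su); rewrite cS in hm *.
move=> /(_ hm) h; rewrite -natr1 mulrDl mul1r.
have := fe x y s xy; rewrite distrC => h2.
by apply: le_trans (ler_distD (f (swap x y s)) _ _) _; rewrite addrC; exact: lerD.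
Qed.
End Swap.

(** * The number of plus spins as a birth-death chain *)

Section Lumping.
Variables (R : realType) (n : nat) (beta : R).
Implicit Types (s u : config n) (v x y : 'I_n) (b : bool).

Lemma natr_plus s : \sum_v (s v)%:R = (plus s)%:R :> R.
Proof.
by rewrite -natr_sum /plus -sum1_card [in RHS]big_mkcond.
Qed.

Lemma mag_plus s : mag R s = 2 * (plus s)%:R - n%:R.
Proof.
rewrite /mag (eq_bigr (fun x => 2 * (s x)%:R - 1)); last first.
  by move=> x _; case: (s x) => /=; rewrite /spin; ring.
rewrite sumrB sumr_const card_ord -mulr_sumr; congr (2 * _ - _).
by rewrite natr_plus.
Qed.

Lemma plus_le s : (plus s <= n)%N.
Proof. by rewrite -[leqRHS](card_ord n) max_card. Qed.

Lemma plus_upd s v b : plus (upd s v b) = (plus s - s v + b)%N.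
Proof.
rewrite /plus (cardD1 v) [#|[pred x | s x]|](cardD1 v) !inE upd_eq addKn addnC.
congr (_ + _)%N; apply: eq_card => w; rewrite !inE; case: eqP => //= /eqP wv.
by rewrite upd_neq.
Qed.

(** The [+ 1] removes the minus spin being resampled from the magnetization [2 k - n]; in
    [down_rate] the [- 1] removes a plus spin. *)
Definition up_rate (k : nat) : R := (n%:R - k%:R) / n%:R *
  ((1 + th (beta * (2 * k%:R - n%:R + 1) / n%:R)) / 2).

Definition down_rate (k : nat) : R := k%:R / n%:R *
  ((1 - th (beta * (2 * k%:R - n%:R - 1) / n%:R)) / 2).

Lemma glauber_op_plus (g : nat -> R) s : (0 < n)%N ->
  glauber_op beta (g \o @plus n) s = bd_step up_rate down_rate g (plus s).
Proof.
move=> n0; rewrite glauber_opE /bd_step; set k := plus s.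
have nR : n%:R != 0 :> R by rewrite pnatr_eq0 -lt0n.
pose P := (1 + th (beta * (2 * k%:R - n%:R + 1) / n%:R)) / 2 : R.
pose Q := (1 - th (beta * (2 * k%:R - n%:R - 1) / n%:R)) / 2 : R.
rewrite (eq_bigr (fun v => g k + (s v)%:R * (Q * (g k.-1 - g k)) +
    (1 - (s v)%:R) * (P * (g k.+1 - g k)))); last first.
  move=> v _ /=; rewrite !plus_upd /lfield mag_plus -/k /P /Q.
  case sv: (s v) => /=; rewrite /spin.
  - have k0 : (0 < k)%N by apply/card_gt0P; exists v; rewrite inE.
    by rewrite subn1 addn0 addn1 prednK//; field.
  - rewrite subn0 addn0 addn1 (_ : _ - -1 = 2 * k%:R - n%:R + 1); last by ring.
    by field.
rewrite !big_split/= -!mulr_suml sumrB natr_plus -/k !sumr_const card_ord.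
rewrite -[g k *+ n]mulr_natl /up_rate /down_rate -/P -/Q.
by field.
Qed.

Lemma iter_op_plus t (g : nat -> R) s : (0 < n)%N ->
  iter t (glauber_op beta) (g \o @plus n) s =
  iter t (bd_step up_rate down_rate) g (plus s).
Proof.
move=> n0; elim: t s => //= t IH s; rewrite -glauber_op_plus//.
by congr (glauber_op _ _ s); apply/funext => u; exact: IH.
Qed.

End Lumping.

(** * Rates of the magnetization chain *)

Section Rates.
Variable R : realType.
Implicit Types (b i m x y : R).

(* In the variable [m = (2 k - n) / n] and with [i = 1 / n], [step_down b i m] is the rate of
   the down-move and [step_down b i (- m)] the rate of the up-move. *)
Definition step_down b i m : R := (1 + m) / 2 * ((1 - th (b * (m - i))) / 2).

Definition drift b i m : R := step_down b i (- m) - step_down b i m.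

(** [th_incr_cubic] is used for lengths up to 4 and with inverse temperature at least 1/2, which
    gives [(1/2)^3 / (32 * 5^3)]. *)
Definition cubic_rate : R := (32 * 10 ^+ 3)^-1.

Lemma cubic_rate_gt0 : 0 < cubic_rate.
Proof. by rewrite invr_gt0 mulr_gt0// exprn_gt0. Qed.

Lemma th_abs_le1 x : `|th x| <= 1.
Proof. by rewrite ler_norml !ltW ?th_lt1 ?th_gtN1. Qed.

Lemma th_upper_tail x : (1 - th x) * (1 + x) <= 1.
Proof.
rewrite /th opprB addrCA subrr addr0.
have := expR_ge1Dx (2 * x); have := expR_gt0 (2 * x); move: (expR _) => e e0 h.
by rewrite mulrAC ler_pdivrMr; lra.
Qed.

Lemma down_ge0 b i m : -1 <= m -> 0 <= step_down b i m.
Proof. by have := th_lt1 (b * (m - i)); rewrite /step_down => ? ?; rewrite mulr_ge0//; lra. Qed.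

(** At [b = 1] and [i = 0] the rate is [(1 + m) * (1 - th m) / 4], at most 1/4 by [th_upper_tail].
    The perturbation leaves it below the 1/3 that the coupling can afford. *)
Lemma down_le b i m : `|b - 1| <= 100^-1 -> 0 <= i <= 100^-1 -> -1 <= m <= 1 ->
  step_down b i m <= 3 / 10.
Proof.
rewrite ler_norml /step_down => /andP[b1 b2] /andP[i0 i1] /andP[m1 m2].
have := th_upper_tail (b * (m - i)); have := th_lt1 (b * (m - i)).
have := th_gtN1 (b * (m - i)).
have e1 : - (b * (m - i)) <= - m + 12^-1.
  have : - (12^-1 : R) <= (b - 1) * (m - i) - i.
    have : `|(b - 1) * (m - i)| <= 100^-1 * 2.
      rewrite normrM; apply: ler_pM => //; first by rewrite ler_norml; lra.
      by rewrite ler_norml; lra.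
    by rewrite ler_norml => /andP[]; lra.
  have -> : b * (m - i) = (b - 1) * (m - i) + m - i by ring.
  lra.
move: e1; move: (th (b * (m - i))) => t; move: (b * (m - i)) => y yE t1 t2 ty.
(* The cut at 1/2 matches the shift [12^-1]: above it, [1 + m <= 6 / 5 * (1 + y)]. *)
have [mh|mh] := leP (1 + m) (2^-1).
  have : (1 + m) * (1 - t) <= 2^-1 * 2 by apply: ler_pM; lra.
  lra.
have : (1 + m) * (1 - t) <= 6 / 5 * (1 + y) * (1 - t) by rewrite ler_pM2r; lra.
lra.
Qed.

Lemma down_ge b i m : 0 <= b <= 2 -> 0 <= i -> 0 <= m <= 1 -> (1 - th 2) / 4 <= step_down b i m.
Proof.
move=> /andP[b0 b2] i0 /andP[m0 m1]; rewrite /step_down.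
have : th (b * (m - i)) <= th 2.
  apply: th_le; apply: (@le_trans _ _ (b * m)); first by rewrite ler_wpM2l//; lra.
  by have := ler_pM b0 m0 b2 m1; rewrite mulr1.
have := th_lt1 (b * (m - i)); have := th_lt1 (2 : R).
move: (th (b * _)) (th 2) => t s s1 t1 ts.
have : 1 * (1 - s) <= (1 + m) * (1 - t) by apply: ler_pM; lra.
lra.
Qed.

Lemma driftN b i m : drift b i (- m) = - drift b i m.
Proof. by rewrite /drift opprK opprB. Qed.

Lemma driftE b i m : drift b i m =
  (- m + (th (b * (m + i)) + th (b * (m - i))) / 2 -
    m / 2 * (th (b * (m + i)) - th (b * (m - i)))) / 2.
Proof.
rewrite /drift /step_down (_ : b * (- m - i) = - (b * (m + i))) ?thN; last by ring.
by field.
Qed.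

Lemma th_gap b i m : th (b * (m + i)) - th (b * (m - i)) =
  th (2 * b * i) * (1 - th (b * (m + i)) * th (b * (m - i))).
Proof.
by rewrite (_ : 2 * b * i = b * (m + i) - b * (m - i)) ?th_sub//; ring.
Qed.

(** The two averaged tangents give the linear and cubic terms. The last term of [driftE] comes from
    excluding the resampled spin; by [th_gap] its increment is a part of favourable sign plus a part
    of size [8 * i * (m' - m)]. *)
Lemma drift_incr b i m m' : 2^-1 <= b <= 2 -> 0 <= i -> -1 <= m -> m <= m' -> m' <= 1 ->
  drift b i m' - drift b i m <=
   ((b - 1) * (m' - m) + 8 * i * (m' - m) - cubic_rate * (m' - m) ^+ 3) / 2.
Proof.
move=> /andP[b1 b2] i0 m1 mm m2; rewrite !driftE.
have D0 : 0 <= m' - m by rewrite subr_ge0.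
set D := m' - m in D0 *.
have bD : 0 <= b * D by rewrite mulr_ge0//; lra.
have cub x : th (b * (m' + x)) - th (b * (m + x)) <= b * D - cubic_rate * D ^+ 3.
  have E : b * (m' + x) - b * (m + x) = b * D by rewrite /D; ring.
  have := @th_incr_cubic R (b * (m + x)) (b * (m' + x)) 4; rewrite E.
  move=> /(_ _)/le_trans; apply.
    by rewrite bD/= (_ : 4 = 2 * 2 :> R); [apply: ler_pM; rewrite // /D; lra|ring].
  rewrite lerD2l lerN2 exprMn [leRHS]mulrAC ler_wpM2r ?exprn_ge0//.
  have h : (2^-1) ^+ 3 <= b ^+ 3 by rewrite lerXn2r ?nnegrE//; lra.
  have -> : cubic_rate = (2^-1) ^+ 3 / (32 * (1 + 4) ^+ 3).
    by rewrite /cubic_rate; field.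
  by rewrite ler_wpM2r// invr_ge0 mulr_ge0// exprn_ge0// addr_ge0.
have lip x : 0 <= th (b * (m' + x)) - th (b * (m + x)) <= b * D.
  have E : b * (m + x) <= b * (m' + x) by rewrite ler_wpM2l//; lra.
  rewrite subr_ge0 th_le//=; apply: le_trans (th_incr_le_id E) _.
  by rewrite /D; lra.
have := cub i; have := cub (- i); have /andP[a1 a2] := lip i; have /andP[a3 a4] := lip (- i).
rewrite !th_gap.
have T0 : 0 <= th (2 * b * i) by apply: th_ge0; rewrite !mulr_ge0//; lra.
have T1 : th (2 * b * i) <= 4 * i.
  apply: le_trans (@th_le_id _ _ _) _; first by rewrite !mulr_ge0//; lra.
  by rewrite ler_wpM2r//; lra.
have := th_abs_le1 (b * (m' + i)); have := th_abs_le1 (b * (m' - i)).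
have := th_abs_le1 (b * (m + i)); have := th_abs_le1 (b * (m - i)).
rewrite !ler_norml.
move: (th (2 * b * i)) (th (b * (m' + i))) (th (b * (m' - i)))
  (th (b * (m + i))) (th (b * (m - i))) T0 T1 a1 a2 a3 a4.
move=> T p' q' p q T0 T1 a1 a2 a3 a4 /andP[q1 q2] /andP[p1 p2] /andP[q3 q4] /andP[p3 p4] c1 c2.
have mE : m' = m + D by rewrite /D; ring.
have g1 : 0 <= D * (T * (1 - p' * q')).
  by rewrite !mulr_ge0// subr_ge0; nra.
have g2 : `|p' * q' - p * q| <= 4 * D.
  rewrite (_ : _ - _ = (p' - p) * q' + p * (q' - q)); last by ring.
  apply: le_trans (ler_normD _ _) _; rewrite !normrM.
  have -> : 4 * D = 2 * D * 1 + 1 * (2 * D) by ring.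
  have h1 : b * D <= 2 * D by rewrite ler_wpM2r.
  by apply: lerD; apply: ler_pM => //; rewrite ler_norml; lra.
have g3 : `|m * (T * (p' * q' - p * q))| <= 1 * (4 * i * (4 * D)).
  rewrite !normrM; apply: ler_pM => //; rewrite ?mulr_ge0//.
    by rewrite ler_norml; lra.
  by apply: ler_pM => //; rewrite ler_norml; lra.
move: g3; rewrite ler_norml => /andP[g3 g4].
rewrite mE.
move: g1 g3 g4 c1 c2; set d3 := D ^+ 3.
have -> : T * (1 - p' * q') = T - T * p' * q' by ring.
have -> : T * (1 - p * q) = T - T * p * q by ring.
have -> : T * (p' * q' - p * q) = T * p' * q' - T * p * q by ring.
lra.
Qed.

(** The drift is odd, so its increment from [- m] to [m] is twice its value at [m]. *)
Lemma drift_mul_le b i m : 2^-1 <= b <= 2 -> 0 <= i -> -1 <= m <= 1 ->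
  m * drift b i m <= ((b - 1) * m ^+ 2 + 8 * i * m ^+ 2 - 4 * cubic_rate * m ^+ 4) / 2.
Proof.
move=> hb i0; wlog m0 : m / 0 <= m => [H m1|/andP[m1 m2]].
  have [|/ltW m0] := leP 0 m; first by move=> ?; exact: H.
  have := H (- m); rewrite driftN mulrNN sqrrN.
  by rewrite (_ : (- m) ^+ 4 = m ^+ 4); [apply; lra|ring].
have /(_ _ _ _)/(ler_wpM2l m0) := @drift_incr b i (- m) m hb i0.
rewrite driftN => /(_ _ _ _); set d := drift b i m.
have -> : m ^+ 4 = m * m ^+ 3 by ring.
have -> : m ^+ 2 = m * m by ring.
have -> : m - - m = 2 * m by ring.
have -> : (2 * m) ^+ 3 = 8 * m ^+ 3 by ring.
by move=> h; have := h ltac:(lra) ltac:(lra) ltac:(lra); lra.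
Qed.

Lemma th_ge_cubic_abs x : x - `|x| ^+ 3 <= th x.
Proof.
have [x0|x0] := leP 0 x; first by rewrite ger0_norm// th_ge_cubic.
have := @th_le_id R (- x) ltac:(lra); rewrite thN => h.
by have : 0 <= `|x| ^+ 3 by []; lra.
Qed.

(** Densities are multiples of [1 / n], hence the alternative on [m]. It gives
    [|m + i|, |m - i| <= 2 |m|], so the shifts by [i] enter the cubic error only through a
    constant. *)
Lemma drift_mul_ge b i m : 2^-1 <= b <= 2 -> 0 <= i -> -1 <= m <= 1 ->
  (m = 0 \/ i <= `|m|) ->
  - (`|b - 1| * m ^+ 2 + 4 * i * m ^+ 2 + 64 * m ^+ 4) / 2 <= m * drift b i m.
Proof.
move=> hb i0; wlog m0 : m / 0 <= m => [H m1 hm|/andP[m1 m2]].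
  have [|/ltW m0] := leP 0 m; first by move=> ?; exact: H.
  have := H (- m); rewrite driftN mulrNN sqrrN normrN.
  rewrite (_ : (- m) ^+ 4 = m ^+ 4); last by ring.
  apply; [lra|lra|].
  by case: hm => [->|]; [left; rewrite oppr0|right].
move=> hm; have {}hm : m = 0 \/ i <= m by move: hm; rewrite ger0_norm.
have [->|im] := hm; first by rewrite !expr0n/= !mulr0 mul0r !addr0 oppr0 mul0r.
case/andP: hb => b1 b2.
rewrite driftE th_gap.
have := th_ge_cubic_abs (b * (m + i)); have := th_ge_cubic_abs (b * (m - i)).
have w x : `|x| <= 2 * m -> `|b * x| ^+ 3 <= 64 * m ^+ 3.
  move=> hx; rewrite (_ : 64 * _ = (4 * m) ^+ 3); last by ring.
  rewrite lerXn2r ?nnegrE ?mulr_ge0// normrM.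
  rewrite (_ : 4 * m = 2 * (2 * m)); last by ring.
  by apply: ler_pM => //; rewrite ger0_norm; lra.
have := w (m + i) ltac:(rewrite ler_norml; lra).
have := w (m - i) ltac:(rewrite ler_norml; lra).
have T0 : 0 <= th (2 * b * i) by apply: th_ge0; rewrite !mulr_ge0//; lra.
have T1 : th (2 * b * i) <= 4 * i.
  apply: le_trans (@th_le_id _ _ _) _; first by rewrite !mulr_ge0//; lra.
  by rewrite ler_wpM2r//; lra.
have := th_abs_le1 (b * (m + i)); have := th_abs_le1 (b * (m - i)).
rewrite !ler_norml; move: (`|_| ^+ 3) (`|_| ^+ 3) => u v.
move: (th (2 * b * i)) (th (b * (m + i))) (th (b * (m - i))) T0 T1.
move=> T p q T0 T1 /andP[q1 q2] /andP[p1 p2] hu hv hq hp.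
have g : T * (1 - p * q) <= 4 * i * 2 by apply: ler_pM => //; nra.
have bm : - `|b - 1| <= b - 1 by rewrite lerNl -normrN ler_norm.
move: bm; set B := `|b - 1| => bm.
have -> : m ^+ 4 = m * m ^+ 3 by ring.
have -> : m ^+ 2 = m * m by ring.
have -> : - (B * (m * m) + 4 * i * (m * m) + 64 * (m * m ^+ 3)) / 2 =
  m * (- (B * m + 4 * i * m + 64 * m ^+ 3) / 2) by field.
apply: ler_wpM2l => //.
have := ler_wpM2l m0 g; have := ler_wpM2l m0 bm.
lra.
Qed.

End Rates.

(** * Upper bound on the mixing time *)

Section TotalVariation.
Variables (R : realType) (n : nat) (beta : R).
Implicit Types (s u : config n) (f : config n -> R).
Local Notation op := (@glauber_op R n beta).
Local Notation mu := (@cw_mu R n beta).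

Lemma iter_op_mu t f : (0 < n)%N -> \sum_s mu s * iter t op f s = \sum_s mu s * f s.
Proof. by move=> n0; elim: t => //= t IH; rewrite glauber_op_mu. Qed.

(** For the sign [f] of the difference of the two laws, the l1 distance is [F s] minus the mean of
    [F], by stationarity; this is an average of oscillations of [F]. *)
Lemma dmax_le t (e : R) : (0 < n)%N -> 0 <= e ->
  (forall f, (forall s, `|f s| <= 1) -> forall s u, iter t op f s - iter t op f u <= 2 * e) ->
  dmax n beta t <= e.
Proof.
move=> n0 e0 H; rewrite /dmax; apply/bigmax_leP; split => // s _.
rewrite /tv_dist ler_pdivrMl//.
pose f u : R := if 0 <= glauber_t beta t s u - mu u then 1 else -1.
have f1 u : `|f u| <= 1 by rewrite /f; case: ifP; rewrite ?normrN normr1.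
have := H f f1 s; set F := iter t op f => HF.
rewrite (eq_bigr (fun u => glauber_t beta t s u * f u - mu u * f u)); last first.
  move=> u _; rewrite -mulrBl /f; case: ifP => [h|/negbT].
    by rewrite mulr1 ger0_norm.
  by rewrite -ltNge => /ltW/ler0_norm ->; rewrite mulrN1.
rewrite sumrB glauber_tE -/F -(iter_op_mu t f n0) -/F.
have -> : F s = \sum_u mu u * F s by rewrite -mulr_suml cw_mu_sum1 mul1r.
rewrite -sumrB (_ : 2 * e = \sum_u mu u * (2 * e)); last first.
  by rewrite -mulr_suml cw_mu_sum1 mul1r.
by apply: ler_sum => u _; rewrite -mulrBr ler_pM2l ?cw_mu_gt0.
Qed.

Lemma tv_dist_le_dmax t s : tv_dist beta t s <= dmax n beta t.
Proof. by rewrite /dmax; exact: le_bigmax. Qed.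

End TotalVariation.

(** * Rates and oscillations in the critical window *)

Section NearCritical.
Variable R : realType.

Definition density (n k : nat) : R := (2 * k%:R - n%:R) / n%:R.

Variables (n : nat) (beta K : R).
Hypothesis n_gt0 : (0 < n)%N.
Hypothesis beta_near : `|beta - 1| <= K / Num.sqrt n%:R.
Hypothesis beta_near1 : `|beta - 1| <= 100^-1.
Hypothesis n_large : n%:R^-1 <= 100^-1 :> R.
Local Notation op := (@glauber_op R n beta).
Implicit Types (s u : config n) (f : config n -> R).

Local Notation i := (n%:R^-1 : R).
Local Notation m := (density n).

Let nR : 0 < n%:R :> R. Proof. by rewrite ltr0n. Qed.

Let i_bnd : 0 <= i <= 100^-1.
Proof. by rewrite n_large andbT invr_ge0 ltW. Qed.

Let beta_bnd : 2^-1 <= beta <= 2.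
Proof. by move: beta_near1; rewrite ler_norml => /andP[? ?]; apply/andP; split; lra. Qed.

Lemma mag_bnd k : (k <= n)%N -> -1 <= m k <= 1.
Proof.
move=> kn; have : k%:R <= n%:R :> R by rewrite ler_nat.
have : 0 <= k%:R :> R by [].
by move=> ? ?; rewrite /density ler_pdivlMr// ler_pdivrMr//; apply/andP; split; lra.
Qed.

Lemma down_rateE k : down_rate n beta k = step_down beta i (m k).
Proof.
rewrite /down_rate /step_down /density.
have -> : beta * (2 * k%:R - n%:R - 1) / n%:R =
  beta * ((2 * k%:R - n%:R) / n%:R - n%:R^-1) by field; rewrite gt_eqF.
by congr (_ * _); field; rewrite gt_eqF.
Qed.

Lemma up_rateE k : up_rate n beta k = step_down beta i (- m k).
Proof.
rewrite /up_rate /step_down /density.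
rewrite (_ : beta * (- _ - _) = - (beta * (2 * k%:R - n%:R + 1) / n%:R)) ?thN ?opprK.
  by congr (_ * _); field; rewrite gt_eqF.
by field; rewrite gt_eqF.
Qed.

(** This is [n^(-3/4)], the [h] of [bd_mixing]. *)
Definition scale : R := (Num.sqrt (n%:R * Num.sqrt n%:R))^-1.

Lemma nsqrt_gt0 : 0 < n%:R * Num.sqrt n%:R :> R.
Proof. by rewrite mulr_gt0// sqrtr_gt0. Qed.

Lemma scale2 : scale ^+ 2 = (n%:R * Num.sqrt n%:R)^-1.
Proof. by rewrite /scale exprVn sqr_sqrtr// ltW// nsqrt_gt0. Qed.

Lemma scale4 : scale ^+ 4 = (n%:R ^+ 3)^-1.
Proof.
rewrite (_ : 4 = 2 * 2)%N// exprM scale2 exprVn exprMn sqr_sqrtr ?(ltW nR)//.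
by rewrite -exprSr.
Qed.

Lemma sqrt_ge1 : 1 <= Num.sqrt n%:R :> R.
Proof. by rewrite -[leLHS]sqrtr1 ler_sqrt// ler1n. Qed.

Lemma scale_bnd : 0 < scale <= 1.
Proof.
have h : 1 <= n%:R * Num.sqrt n%:R :> R.
  by rewrite -[leLHS]mulr1; apply: ler_pM => //; rewrite ?sqrt_ge1// ler1n.
rewrite invr_gt0 sqrtr_gt0 nsqrt_gt0/= invf_le1 ?sqrtr_gt0 ?nsqrt_gt0//.
by rewrite -[leLHS]sqrtr1 ler_sqrt// ltW// nsqrt_gt0.
Qed.

Lemma inv_n2_le : i ^+ 2 <= scale ^+ 2.
Proof.
rewrite scale2 exprVn lef_pV2 ?posrE ?exprn_gt0 ?nsqrt_gt0// expr2 ler_pM2l//.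
rewrite -[leRHS](sqr_sqrtr (ltW nR)) expr2 ler_peMl ?sqrt_ge1//.
Qed.

Lemma near_le : `|beta - 1| * i <= K * scale ^+ 2.
Proof.
by rewrite scale2 invfM mulrCA mulrC ler_pM2l ?invr_gt0//.
Qed.

(** Counts at distance [d] have densities at distance [2 d / n], which turns [cubic_rate / 2] into
    [4 * cubic_rate]. The spin-exclusion term is of order [d / n^2], below [d * scale ^+ 2]. *)
Lemma rate_drift k l : (k < l <= n)%N ->
  (up_rate n beta l - down_rate n beta l) - (up_rate n beta k - down_rate n beta k) <=
  (K + 8) * (l - k)%:R * scale ^+ 2 - 4 * cubic_rate R * (l - k)%:R ^+ 3 * scale ^+ 4.
Proof.
move=> /andP[kl ln].
rewrite !up_rateE !down_rateE -![step_down _ _ (- _) - _]/(drift _ _ _).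
have kn : (k <= n)%N by apply: leq_trans ln; exact: ltnW.
have /andP[k1 _] := mag_bnd kn; have /andP[_ l1] := mag_bnd ln.
have /andP[i0 _] := i_bnd.
set d : R := (l - k)%:R.
have dE : m l - m k = 2 * (d * i).
  by rewrite /d natrB ?(ltnW kl)// /density; field; rewrite gt_eqF.
have d0 : 0 <= d by [].
have kl' : m k <= m l by rewrite -subr_ge0 dE !mulr_ge0.
apply: le_trans (drift_incr beta_bnd i0 k1 kl' l1) _.
rewrite dE scale4.
have -> : (2 * (d * i)) ^+ 3 = 8 * (d ^+ 3 * (n%:R ^+ 3)^-1).
  by field; rewrite gt_eqF.
have h1 : (beta - 1) * (d * i) <= K * d * scale ^+ 2.
  rewrite (_ : _ * (d * i) = (beta - 1) * i * d); last by ring.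
  rewrite (_ : K * d * _ = K * scale ^+ 2 * d); last by ring.
  rewrite ler_wpM2r//; apply: le_trans near_le; rewrite ler_wpM2r//.
  exact: ler_norm.
have h2 : i * (d * i) <= d * scale ^+ 2.
  by rewrite mulrCA ler_wpM2l// -expr2 inv_n2_le.
by lra.
Qed.

(** Single rates vanish at the ends, but either [k] has nonpositive density and its up rate is
    large, or [l] has positive density and its down rate is large. *)
Lemma rate_sum k l : (k < l <= n)%N ->
  (1 - th 2) / 4 <= up_rate n beta k + down_rate n beta l.
Proof.
move=> /andP[kl ln]; have kn : (k <= n)%N by apply: leq_trans ln; exact: ltnW.
have /andP[k1 k2] := mag_bnd kn; have /andP[l1 l2] := mag_bnd ln.
have /andP[i0 _] := i_bnd.
have b02 : 0 <= beta <= 2 by case/andP: beta_bnd => ? ?; apply/andP; split; lra.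
rewrite up_rateE down_rateE; have [mk|mk] := leP (m k) 0.
  have : (1 - th 2) / 4 <= step_down beta i (- m k) by apply: down_ge => //; lra.
  have : 0 <= step_down beta i (m l) by exact: down_ge0.
  lra.
have ml : m k <= m l.
  by rewrite /density ler_pM2r ?invr_gt0// lerB// ler_pM2l// ler_nat ltnW.
have : (1 - th 2) / 4 <= step_down beta i (m l) by apply: down_ge => //; lra.
have : 0 <= step_down beta i (- m k) by apply: down_ge0; lra.
lra.
Qed.

Lemma rate_bnd k : (k <= n)%N ->
  0 <= up_rate n beta k <= 3 / 10 /\ 0 <= down_rate n beta k <= 3 / 10.
Proof.
move=> /mag_bnd/andP[k1 k2]; rewrite up_rateE down_rateE.
have k3 : -1 <= - m k by lra.
have k4 : - m k <= 1 by lra.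
by rewrite !down_ge0 ?down_le ?i_bnd ?k1 ?k2 ?k3 ?k4.
Qed.

Lemma lfield_bnd s v : `|lfield beta s v| <= 2.
Proof.
rewrite /lfield -mulrA normrM.
have : `|mag R s - spin R (s v)| <= n%:R.
  rewrite /mag (bigD1 v)//= addrAC subrr add0r.
  apply: le_trans (ler_norm_sum _ _ _) _.
  rewrite (eq_bigr (fun=> 1)); last first.
    by move=> w _; case: (s w); rewrite /spin ?normrN normr1.
  by rewrite sumr_const cardC1 card_ord ler_nat leq_pred.
move=> h; rewrite -[leRHS]mulr1; apply: ler_pM => //.
  by rewrite ger0_norm; case/andP: beta_bnd; lra.
by rewrite normrM normfV [`|n%:R|]gtr0_norm// ler_pdivrMr// mul1r.
Qed.

Lemma rate_ge s v b : (1 - th 2) / 2 <= (1 + spin R b * th (lfield beta s v)) / 2.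
Proof.
have := lfield_bnd s v; rewrite ler_norml => /andP[/th_le h1 /th_le h2].
move: h1 h2; rewrite thN; case: b; rewrite /spin ?mul1r ?mulN1r; lra.
Qed.

(** Functions evolve backwards: the inner [t] iterations, the last [t] steps of the chain, make [f]
    nearly a function of the plus count; the outer [t] are left to the birth-death chain. The errors
    add up as [1/8 + 1/4 + 1/8]. *)
Lemma osc_le (A : R) : 0 < A ->
  (forall (g : nat -> R) (t k l : nat), (forall k, `|g k| <= 1) ->
    (k <= n)%N -> (l <= n)%N ->
    t%:R * `|iter t (bd_step (up_rate n beta) (down_rate n beta)) g k -
             iter t (bd_step (up_rate n beta) (down_rate n beta)) g l|
      <= A / scale ^+ 2) ->
  forall t, 4 * A * (n%:R * Num.sqrt n%:R) <= t%:R ->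
  2 * n%:R * (1 - (1 - th 2) / 2 * i) ^+ t <= 8^-1 ->
  forall f, (forall s, `|f s| <= 1) -> forall s u,
   iter (t + t) op f s - iter (t + t) op f u <= 2^-1.
Proof.
move=> A0 HA t tA te f f1 s u.
rewrite !iterD; set f1' := iter t op f.
set e := (1 - _ * i) ^+ t in te.
have c0 : 0 <= (1 - th 2) / 2 :> R by have := th_lt1 (2 : R); lra.
have f1n z : `|f1' z| <= 1 by exact: iter_op_norm.
have e0 : 0 <= e.
  have /andP[i0 i1] := i_bnd; have := th_gtN1 (2 : R) => t2.
  apply: exprn_ge0; rewrite subr_ge0 -[leRHS]mulr1.
  by apply: ler_pM; rewrite ?c0//; lra.
have sym z z' : plus z = plus z' -> `|f1' z - f1' z'| <= 8^-1.
  move=> zz; apply: le_trans te; rewrite (mulrC 2) -mulrA.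
  apply: plus_eq_diff => //; first by rewrite mulr_ge0.
  by move=> x y w xy; exact: (iter_op_antisym rate_ge).
(* Any representative of a plus count serves, up to 1/8; counts without a configuration get 0. *)
pose g (k : nat) : R := if [pick z : config n | plus z == k] is Some z then f1' z else 0.
have g1 k : `|g k| <= 1 by rewrite /g; case: pickP => // _; rewrite normr0.
have fg z : `|f1' z - (g \o @plus n) z| <= 8^-1.
  by rewrite /= /g; case: pickP => [z' /eqP/esym/sym//|/(_ z)]; rewrite eqxx.
have E z : `|iter t op f1' z - iter t (bd_step (up_rate n beta) (down_rate n beta)) g (plus z)| <= 8^-1.
  by rewrite -iter_op_plus// -iter_opB; exact: iter_op_norm.
have := HA g t (plus s) (plus u) g1 (plus_le s) (plus_le u).
rewrite scale2 invrK => H.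
have t0 : 0 < t%:R :> R by apply: lt_le_trans tA; rewrite mulr_gt0 ?nsqrt_gt0// mulr_gt0.
have {}H : `|iter t (bd_step (up_rate n beta) (down_rate n beta)) g (plus s) -
  iter t (bd_step (up_rate n beta) (down_rate n beta)) g (plus u)| <= 4^-1.
  by rewrite -(ler_pM2l t0); apply: le_trans H _; lra.
by move: H (E s) (E u); rewrite !ler_norml => /andP[? ?] /andP[? ?] /andP[? ?]; lra.
Qed.

End NearCritical.

Lemma natr_large (R : realType) (x : R) :
  exists N : nat, forall n : nat, (N <= n)%N -> x <= n%:R.
Proof.
exists (Num.truncn x).+1 => n hn; apply: le_trans (ltW (truncnS_gt x)) _.
by rewrite ler_nat.
Qed.

Lemma window_small (R : realType) (K x y : R) : 0 < K -> 0 < x -> (100 * K) ^+ 2 <= x ->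
  `|y| <= K / Num.sqrt x -> `|y| <= 100^-1.
Proof.
move=> K0 x0 Kx hy; apply: le_trans hy _.
have s0 : 0 < Num.sqrt x by rewrite sqrtr_gt0.
rewrite ler_pdivrMr// mulrC ler_pdivlMr// mulrC.
rewrite -(@ler_pXn2r _ 2) ?nnegrE ?(ltW s0) ?mulr_ge0 ?(ltW K0)//.
by rewrite sqr_sqrtr// ltW.
Qed.

Lemma mixing_upper (R : realType) (K : R) : 0 < K ->
  exists2 C : R, 0 < C & exists N : nat, forall (n : nat) (beta : R), (N <= n)%N ->
    `|beta - 1| <= K / Num.sqrt n%:R ->
  exists T : nat, [/\ (0 < T)%N, T%:R <= C * (n%:R * Num.sqrt n%:R) &
    dmax n beta T <= 4^-1].
Proof.
move=> K0.
have t2 : th 2 < 1 :> R by exact: th_lt1.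
have c00 : 0 < (1 - th 2) / 4 :> R by lra.
have K8 : 0 < K + 8 by lra.
have c10 : 0 < 4 * cubic_rate R by rewrite mulr_gt0// cubic_rate_gt0.
have [A A0 HA] := bd_mixing K8 c00 c10.
exists (8 * A + 4); first by rewrite addr_gt0// mulr_gt0.
pose c : R := (1 - th 2) / 2.
have c0 : 0 < c by rewrite /c; lra.
have [N1 hN1] := natr_large (100 : R).
have [N2 hN2] := natr_large ((100 * K) ^+ 2).
(* From here on [y ^ 4 / 24], a lower bound of [e ^ y] at [y = c * sqrt n], beats [16 n]. *)
have [N3 hN3] := natr_large (16 * 24 / c ^+ 4).
exists (maxn N1 (maxn N2 N3)) => n beta; rewrite !geq_max => /and3P[/hN1 n1 /hN2 n2 /hN3 n3] near.
have nR : 0 < n%:R :> R by lra.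
have n0 : (0 < n)%N by rewrite -(ltr0n R).
have s0 : 0 < Num.sqrt n%:R :> R by rewrite sqrtr_gt0.
have ss : Num.sqrt n%:R ^+ 2 = n%:R :> R by rewrite sqr_sqrtr// ltW.
have near1 := window_small K0 nR n2 near.
have nl : n%:R^-1 <= 100^-1 :> R by rewrite lef_pV2 ?posrE.
set q := n%:R * Num.sqrt n%:R.
have q0 : 0 < q by exact: nsqrt_gt0.
have q1 : 1 <= q by rewrite -[leLHS]mulr1; apply: ler_pM; rewrite ?sqrt_ge1//; lra.
(* The part [4 * A * q] serves the birth-death chain, the extra [q] the exchanges. *)
pose x := (4 * A + 1) * q.
have x0 : 0 <= x by rewrite mulr_ge0 ?ltW// addr_gt0// mulr_gt0.
pose t := (Num.truncn x).+1.
have tx : x < t%:R by exact: truncnS_gt.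
have xt : t%:R <= x + 1 by rewrite /t -natr1 lerD2r truncn_le.
exists (t + t)%N; split; first by rewrite addSn.
  by rewrite natrD; move: xt; rewrite /x; lra.
apply: dmax_le => // f f1 s u.
have -> : 2 * 4^-1 = 2^-1 :> R by field.
have [i0 i1] : 0 <= n%:R^-1 :> R /\ n%:R^-1 <= 1 :> R by split; [rewrite invr_ge0|lra].
apply: (osc_le n0 near1 nl A0) => //.
- move=> g t' k l g1 kn ln.
  apply: (HA n _ _ (scale R n)) => //; first exact: scale_bnd.
  + by move=> k' /(rate_bnd n0 near1 nl)[].
  + by move=> k' /(rate_bnd n0 near1 nl)[].
  + by rewrite /down_rate !mul0r.
  + by rewrite /up_rate subrr !mul0r.
  + by move=> k' l' kl'; exact: (rate_sum n0 near1 nl kl').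
  + by move=> k' l' kl'; exact: (rate_drift n0 near near1 nl kl').
- by apply: le_trans (ltW tx); rewrite /x -/q; lra.
- rewrite -/c.
  have y0 : 0 < c * Num.sqrt n%:R by rewrite mulr_gt0.
  have h : (1 - c * n%:R^-1) ^+ t <= (expR (c * Num.sqrt n%:R))^-1.
    apply: (@le_trans _ _ (expR (- (c * n%:R^-1)) ^+ t)).
      rewrite lerXn2r ?nnegrE ?expR_ge0 ?expR_ge1Dx// subr_ge0 -[leRHS]mulr1.
      by apply: ler_pM => //; rewrite ?(ltW c0)// /c; have := th_gtN1 (2 : R); lra.
    rewrite -expRM_natl -expRN ler_expR mulrN lerN2 mulrCA ler_pM2l// ler_pdivlMr//.
    by rewrite mulrC -/q; apply: le_trans (ltW tx); rewrite /x; nra.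
  have e4 : (c * Num.sqrt n%:R) ^+ 4 / 24 <= expR (c * Num.sqrt n%:R).
    by have := expR_ge1Dxn 3 (ltW y0); rewrite (_ : 4`! = 24)%N//; lra.
  have e5 : (c * Num.sqrt n%:R) ^+ 4 = c ^+ 4 * n%:R ^+ 2.
    by rewrite exprMn -[in RHS]ss -exprM.
  have c4 : 0 < c ^+ 4 by rewrite exprn_gt0.
  have e0 : 0 < expR (c * Num.sqrt n%:R) by exact: expR_gt0.
  apply: le_trans (_ : 2 * n%:R * (expR (c * Num.sqrt n%:R))^-1 <= _).
    by rewrite ler_pM2l// mulr_gt0.
  rewrite ler_pdivrMr//; move: e4; rewrite e5 => e4.
  have n3' : 16 * 24 <= c ^+ 4 * n%:R by rewrite [leRHS]mulrC -ler_pdivrMr.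
  by have := ler_wpM2r (ltW nR) n3'; rewrite -[leRHS]mulrA -expr2; lra.
Qed.

(** * Variance of the magnetization *)

Section Moments.
Variables (R : realType) (n : nat) (beta K : R).
Hypothesis n_gt0 : (0 < n)%N.
Hypothesis K_gt0 : 0 < K.
Hypothesis beta_near : `|beta - 1| <= K / Num.sqrt n%:R.
Hypothesis beta_near1 : `|beta - 1| <= 100^-1.
Hypothesis n_large : n%:R^-1 <= 100^-1 :> R.
Local Notation mu := (@cw_mu R n beta).
Local Notation i := (n%:R^-1 : R).
Local Notation a := (cubic_rate R).
Implicit Type s : config n.

Let nR : 0 < n%:R :> R. Proof. by rewrite ltr0n. Qed.

Lemma glauber_op_mag (G : R -> R) s :
  glauber_op beta (G \o @mag R n) s = G (mag R s) +
    up_rate n beta (plus s) * (G (mag R s + 2) - G (mag R s)) +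
    down_rate n beta (plus s) * (G (mag R s - 2) - G (mag R s)).
Proof.
have -> : G \o @mag R n = (fun k : nat => G (2 * k%:R - n%:R)) \o @plus n.
  by apply/funext => z /=; rewrite mag_plus.
rewrite glauber_op_plus// /bd_step mag_plus.
congr (_ + _ * (G _ - _) + _); first by rewrite -natr1; ring.
have [->|k0] := posnP (plus s); first by rewrite /down_rate !mul0r.
congr (_ * (G _ - _)); have : plus s = (plus s).-1.+1 by rewrite prednK.
by move: (_.-1) => k ->; rewrite -natr1; ring.
Qed.

Lemma stationary_mag (G : R -> R) :
  \sum_s mu s * (up_rate n beta (plus s) * (G (mag R s + 2) - G (mag R s)) +
    down_rate n beta (plus s) * (G (mag R s - 2) - G (mag R s))) = 0.
Proof.
rewrite -[RHS](subrr (\sum_s mu s * (G \o @mag R n) s)).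
rewrite -{1}(glauber_op_mu beta (G \o @mag R n) n_gt0) -sumrB.
apply: eq_bigr => s _.
by rewrite -mulrBr glauber_op_mag /=; congr (_ * _); ring.
Qed.

(** The squared magnetization in its critical unit [n^(3/2)]. *)
Definition scaled_sqr s : R := mag R s ^+ 2 * scale R n ^+ 2.
Local Notation Y := scaled_sqr.

Lemma scaled_sqr_ge0 s : 0 <= Y s.
Proof. by rewrite /Y mulr_ge0 ?sqr_ge0. Qed.

Let b s : R := up_rate n beta (plus s) - down_rate n beta (plus s).

Lemma mag_densityE s : density R n (plus s) = mag R s * i.
Proof. by rewrite /density mag_plus. Qed.

Lemma mag_drift_bnd s :
  - ((K + 4) * Y s + 64 * Y s ^+ 2) / 2 <= mag R s * b s <=
  ((K + 8) * Y s - 4 * a * Y s ^+ 2) / 2.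
Proof.
have b12 : 2^-1 <= beta <= 2.
  by move: beta_near1; rewrite ler_norml => /andP[? ?]; apply/andP; split; lra.
have i0 : 0 <= i by rewrite invr_ge0 ltW.
have m1 := mag_bnd R n_gt0 (plus_le s).
have hm : density R n (plus s) = 0 \/ i <= `|density R n (plus s)|.
  have -> : density R n (plus s) = (2 * (plus s)%:Z - n%:Z)%:~R * i.
    by rewrite /density intrB intrM.
  case: (eqVneq (2 * (plus s)%:Z - n%:Z) 0) => [->|nz]; first by left; rewrite mul0r.
  right; rewrite normrM (ger0_norm i0) ler_peMl// -intr_norm ler1z.
  by rewrite -gtz0_ge1 normr_gt0.
have := drift_mul_le b12 i0 m1; have := drift_mul_ge b12 i0 m1 hm.
rewrite /drift -up_rateE// -down_rateE// -/(b s) mag_densityE.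
set S := mag R s.
have n0 : n%:R != 0 :> R by rewrite gt_eqF.
have Y2 : Y s ^+ 2 = S ^+ 4 * i ^+ 3.
  rewrite /Y exprMn -!exprM (_ : 2 * 2 = 4)%N// scale4// exprVn.
  by [].
have e1 : n%:R * (S * i) ^+ 2 = S ^+ 2 * i by field.
have e2 : n%:R * (S * i) ^+ 4 = Y s ^+ 2 by rewrite Y2; field.
have e3 : n%:R * (S * i * b s) = S * b s by field.
have S2 : 0 <= S ^+ 2 by exact: sqr_ge0.
have h1 : `|beta - 1| * (S ^+ 2 * i) <= K * Y s.
  have -> : `|beta - 1| * (S ^+ 2 * i) = S ^+ 2 * (`|beta - 1| * i) by ring.
  rewrite /Y -/S [leRHS]mulrCA ler_wpM2l//; exact: near_le.
have h2 : i * (S ^+ 2 * i) <= Y s.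
  have -> : i * (S ^+ 2 * i) = S ^+ 2 * i ^+ 2 by ring.
  by rewrite /Y -/S ler_wpM2l// inv_n2_le.
have h3 : (beta - 1) * (S ^+ 2 * i) <= K * Y s.
  by apply: le_trans h1; rewrite ler_wpM2r ?ler_norm// mulr_ge0.
move=> /(ler_wpM2l (ltW nR)) L /(ler_wpM2l (ltW nR)) U.
rewrite e3 in L U; apply/andP; split.
- apply: le_trans L; rewrite -subr_ge0.
  rewrite (_ : _ - _ = ((K + 4) * Y s + 64 * Y s ^+ 2 -
     (`|beta - 1| * (n%:R * (S * i) ^+ 2) + 4 * (i * (n%:R * (S * i) ^+ 2)) +
      64 * (n%:R * (S * i) ^+ 4))) / 2); last by field.
  by rewrite e1 e2; lra.
- apply: le_trans U _; rewrite -subr_ge0.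
  rewrite (_ : _ - _ = ((K + 8) * Y s - 4 * a * Y s ^+ 2 -
     ((beta - 1) * (n%:R * (S * i) ^+ 2) + 8 * (i * (n%:R * (S * i) ^+ 2)) -
      4 * a * (n%:R * (S * i) ^+ 4))) / 2); last by field.
  by rewrite e1 e2; lra.
Qed.

Lemma rate_tot_bnd s :
  (1 - th 2) / 4 <= up_rate n beta (plus s) + down_rate n beta (plus s) <= 1.
Proof.
have [] := rate_bnd n_gt0 beta_near1 n_large (plus_le s).
have /andP[m1 m2] := mag_bnd R n_gt0 (plus_le s).
have b02 : 0 <= beta <= 2.
  by move: beta_near1; rewrite ler_norml => /andP[? ?]; apply/andP; split; lra.
have i0 : 0 <= i by rewrite invr_ge0 ltW.
move=> /andP[p1 p2] /andP[q1 q2]; apply/andP; split; last lra.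
move: p1 q1; rewrite up_rateE// down_rateE//; move: (density _ _ _) m1 m2 => m m1 m2.
move=> p1 q1; have [m0|/ltW m0] := leP 0 m.
  have : (1 - th 2) / 4 <= step_down beta i m by apply: down_ge => //; rewrite m0.
  lra.
have : (1 - th 2) / 4 <= step_down beta i (- m).
  by apply: down_ge => //; apply/andP; split; lra.
lra.
Qed.

(** In equilibrium the mean increment of [S^4] is 0, while after scaling its cubic restoring part
    contributes [- 16 a Y^3]. Half of that absorbs all lower orders, by the hypothesis on
    polynomials. *)
Lemma sixth_moment_le (C : R) :
  (forall y, 0 <= y -> 4 * (K + 8) * y ^+ 2 + (16 * (K + 8) + 24) * y + 16 <=
     8 * a * y ^+ 3 + C) ->
  8 * a * (\sum_s mu s * Y s ^+ 3) <= C.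
Proof.
move=> hC; have a0 := cubic_rate_gt0 R.
have /andP[sc0 sc1] := scale_bnd R n_gt0.
set H := scale R n ^+ 2.
have H0 : 0 <= H by exact: sqr_ge0.
have H1 : H <= 1 by rewrite /H exprn_ile1// ltW.
have := stationary_mag (fun x => x ^+ 4) => /(congr1 ( *%R H)).
rewrite mulr0 mulr_sumr => E0.
rewrite -subr_ge0 (_ : C - _ = \sum_s mu s * (C - 8 * a * Y s ^+ 3)); last first.
  under [RHS]eq_bigr do rewrite mulrBr.
  rewrite sumrB -mulr_suml cw_mu_sum1 mul1r mulr_sumr; congr (_ - _).
  by apply: eq_bigr => s _; ring.
rewrite -[leLHS]E0; apply: ler_sum => s _; rewrite mulrCA ler_pM2l ?cw_mu_gt0//.
have /andP[_ U] := mag_drift_bnd s; have /andP[r1 r2] := rate_tot_bnd s.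
have y0 := scaled_sqr_ge0 s.
have := hC _ y0; set y := Y s in U y0 *; set S := mag R s in U *.
set p := up_rate n beta _ in r1 r2 *; set q := down_rate n beta _ in r1 r2 *.
have -> : H * (p * ((S + 2) ^+ 4 - S ^+ 4) + q * ((S - 2) ^+ 4 - S ^+ 4)) =
    (8 * (S ^+ 2 * H) + 32 * H) * (S * (p - q)) + (24 * (S ^+ 2 * H) + 16 * H) * (p + q).
  by ring.
rewrite -/(Y s) -/y -[p - q]/(b s) => h.
have h1 : (8 * y + 32 * H) * (S * b s) <= (8 * y + 32 * H) * (((K + 8) * y - 4 * a * y ^+ 2) / 2).
  by apply: ler_wpM2l => //; lra.
have h2 : (24 * y + 16 * H) * (p + q) <= 24 * y + 16.
  have : (24 * y + 16 * H) * (p + q) <= (24 * y + 16 * H) * 1 by apply: ler_wpM2l; lra.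
  lra.
have h3 : (8 * y + 32 * H) * (((K + 8) * y - 4 * a * y ^+ 2) / 2) =
  4 * (K + 8) * y ^+ 2 - 16 * a * y ^+ 3 + 16 * (K + 8) * (H * y) - 64 * a * H * y ^+ 2.
  by field.
have h4 : 0 <= a * (H * y ^+ 2).
  by apply: mulr_ge0; [exact: ltW|apply: mulr_ge0 => //; exact: sqr_ge0].
have h5 : 16 * (K + 8) * (H * y) <= 16 * (K + 8) * y.
  by rewrite ler_pM2l ?ler_piMl//; have := K_gt0; lra.
rewrite h3 in h1; lra.
Qed.

(** Stationarity of [S^2] balances the noise [p + q], bounded below, against a restoring term of
    order at most [Y + Y^2]. The sixth moment keeps rare large values from carrying this balance:
    [Y^2] is interpolated between [Y] and a small multiple of [Y^3]. *)
Lemma second_moment_ge (C A : R) : 0 < A -> \sum_s mu s * Y s ^+ 3 <= C ->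
  128 * C <= A * (1 - th 2) ->
  (1 - th 2) / 4 <= (K + 4 + 32 * A) * (\sum_s mu s * Y s).
Proof.
move=> A0 hC hA.
have E0 := stationary_mag (fun x => x ^+ 2).
set c : R := (1 - th 2) / 4.
have key : 0 <= \sum_s mu s * (2 * ((K + 4 + 32 * A) * Y s + 32 / A * Y s ^+ 3) - 4 * c).
  have : \sum_s mu s * (- (2 * ((K + 4 + 32 * A) * Y s + 32 / A * Y s ^+ 3) - 4 * c)) <= 0.
    rewrite -[leRHS]E0; apply: ler_sum => s _; rewrite ler_pM2l ?cw_mu_gt0//.
    have /andP[L _] := mag_drift_bnd s; have /andP[r1 r2] := rate_tot_bnd s.
    have y0 := scaled_sqr_ge0 s; set y := Y s in L y0 *; set S := mag R s in L *.
    set p := up_rate n beta _ in r1 r2 *; set q := down_rate n beta _ in r1 r2 *.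
    have -> : p * ((S + 2) ^+ 2 - S ^+ 2) + q * ((S - 2) ^+ 2 - S ^+ 2) =
      4 * (S * (p - q)) + 4 * (p + q) by ring.
    rewrite -[p - q]/(b s).
    (* AM-GM: [2 y ^ 2 <= A y + y ^ 3 / A] *)
    have amgm : 0 <= y * (A - y) ^+ 2 / A.
      by rewrite divr_ge0 ?(ltW A0)// mulr_ge0// sqr_ge0.
    have : y * (A - y) ^+ 2 / A = A * y - 2 * y ^+ 2 + y ^+ 3 / A.
      by field; rewrite gt_eqF.
    rewrite (_ : 32 / A * y ^+ 3 = 32 * (y ^+ 3 / A)); last by field; rewrite gt_eqF.
    by rewrite -/c in r1; lra.
  under eq_bigr do rewrite mulrN.
  by rewrite sumrN oppr_le0.
move: key; set X := \sum_s mu s * Y s; set Z := \sum_s _ in hC.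
have -> : \sum_s mu s * (2 * ((K + 4 + 32 * A) * Y s + 32 / A * Y s ^+ 3) - 4 * c) =
   2 * ((K + 4 + 32 * A) * X + 32 / A * Z) - 4 * c.
  rewrite (eq_bigr (fun s => 2 * (K + 4 + 32 * A) * (mu s * Y s) +
     2 * (32 / A) * (mu s * Y s ^+ 3) - mu s * (4 * c))); last by move=> s _; ring.
  rewrite sumrB big_split/= -!mulr_sumr -mulr_suml cw_mu_sum1 mul1r -/X -/Z.
  by ring.
have : 32 / A * Z <= c.
  apply: (@le_trans _ _ (32 / A * C)); first by rewrite ler_pM2l// divr_gt0.
  rewrite mulrAC ler_pdivrMr// /c; lra.
lra.
Qed.

End Moments.

Lemma variance_lower (R : realType) (K : R) : 0 < K ->
  exists2 c : R, 0 < c & exists N : nat, forall (n : nat) (beta : R), (N <= n)%N ->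
    `|beta - 1| <= K / Num.sqrt n%:R ->
    c * (n%:R * Num.sqrt n%:R) <= \sum_(s : config n) cw_mu beta s * mag R s ^+ 2.
Proof.
move=> K0; have a0 := cubic_rate_gt0 R; set a := cubic_rate R in a0.
(* [M] adds up the coefficients, so the left-hand side of [hC] is at most [M * max 1 y ^ 2]; beyond
   [B] the cubic term dominates it, below [B] the constant [C] does. *)
pose M := 4 * (K + 8) + (16 * (K + 8) + 24) + 16.
have M0 : 0 < M by rewrite /M; lra.
pose B := 1 + M / (8 * a).
have B1 : 1 <= B by rewrite /B lerDl divr_ge0 ?mulr_ge0// ltW.
pose C := M * B ^+ 2.
have C0 : 0 < C by rewrite mulr_gt0// exprn_gt0//; lra.
have hC y : 0 <= y -> 4 * (K + 8) * y ^+ 2 + (16 * (K + 8) + 24) * y + 16 <=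
     8 * a * y ^+ 3 + C.
  move=> y0; pose z := Num.max 1 y.
  have z1 : 1 <= z by rewrite le_max lexx.
  have yz : y <= z by rewrite le_max lexx orbT.
  have h1 : 4 * (K + 8) * y ^+ 2 + (16 * (K + 8) + 24) * y + 16 <= M * z ^+ 2.
    have -> : M * z ^+ 2 = 4 * (K + 8) * z ^+ 2 + (16 * (K + 8) + 24) * z ^+ 2 + 16 * z ^+ 2.
      by rewrite /M; ring.
    have yz2 : y ^+ 2 <= z ^+ 2 by rewrite lerXn2r ?nnegrE//; lra.
    have z2 : 1 <= z ^+ 2 by rewrite exprn_ege1.
    have yz3 : y <= z ^+ 2 by apply: le_trans yz _; rewrite expr2 ler_peMl//; lra.
    apply: lerD; [apply: lerD|].
    - by rewrite ler_wpM2l//; lra.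
    - by rewrite ler_wpM2l//; lra.
    - by rewrite ler_peMr.
  apply: le_trans h1 _; have [yB|yB] := leP y B.
    have zB : z <= B by rewrite ge_max B1.
    have : 0 <= 8 * a * y ^+ 3 by rewrite !mulr_ge0 ?exprn_ge0// ltW.
    have : M * z ^+ 2 <= C by rewrite ler_pM2l// lerXn2r ?nnegrE//; lra.
    lra.
  have -> : z = y by apply/max_idPr; lra.
  have : M * y ^+ 2 <= 8 * a * y ^+ 3.
    rewrite [y ^+ 3]exprS [leRHS]mulrA ler_wpM2r ?sqr_ge0//.
    have e : 8 * a * B = 8 * a + M by rewrite /B; field; rewrite gt_eqF.
    have : 8 * a * B <= 8 * a * y by rewrite ler_pM2l ?mulr_gt0// ltW.
    by rewrite e; lra.
  by have := ltW C0; lra.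
have t2 : 0 < 1 - th 2 :> R by have := th_lt1 (2 : R); lra.
pose C' := C / (8 * a).
have C'0 : 0 < C' by rewrite divr_gt0// mulr_gt0.
pose A := 128 * C' / (1 - th 2).
have A0 : 0 < A by rewrite divr_gt0// mulr_gt0.
have KA : 0 < K + 4 + 32 * A by lra.
exists ((1 - th 2) / 4 / (K + 4 + 32 * A)); first by rewrite !divr_gt0.
have [N1 hN1] := natr_large (100 : R).
have [N2 hN2] := natr_large ((100 * K) ^+ 2).
exists (maxn N1 N2) => n beta; rewrite geq_max => /andP[/hN1 n1 /hN2 n2] near.
have nR : 0 < n%:R :> R by lra.
have n0 : (0 < n)%N by rewrite -(ltr0n R).
have near1 := window_small K0 nR n2 near.
have nl : n%:R^-1 <= 100^-1 :> R by rewrite lef_pV2 ?posrE.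
have m6 := sixth_moment_le n0 K0 near near1 nl hC.
have {}m6 : \sum_(s : config n) cw_mu beta s * scaled_sqr R s ^+ 3 <= C'.
  by rewrite /C' ler_pdivlMr ?mulr_gt0// mulrC.
have hA : 128 * C' <= A * (1 - th 2) by rewrite /A divfK// gt_eqF.
have := second_moment_ge n0 near near1 nl A0 m6 hA.
have -> : \sum_(s : config n) cw_mu beta s * scaled_sqr R s =
    (\sum_(s : config n) cw_mu beta s * mag R s ^+ 2) / (n%:R * Num.sqrt n%:R).
  by rewrite mulr_suml; apply: eq_bigr => s _; rewrite /scaled_sqr scale2// mulrA.
rewrite [leRHS]mulrA ler_pdivlMr ?nsqrt_gt0// => h.
by rewrite mulrAC ler_pdivrMr// [leRHS]mulrC.
Qed.

(** * Rayleigh quotients *)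

Section Rayleigh.
Variables (R : realType) (T : finType) (m : T -> R) (P : T -> T -> R).
Implicit Types (f g : T -> R) (s u : T).
Hypothesis m_gt0 : forall s, 0 < m s.
Hypothesis reversible : forall s u, m s * P s u = m u * P u s.
Hypothesis P_sum1 : forall s, \sum_u P s u = 1.

Let dot f g : R := \sum_s m s * (f s * g s).
Let op f s : R := \sum_u P s u * f u.

Let dot_form f g : dot f (op g) = \sum_s \sum_u m s * P s u * (f s * g u).
Proof.
by apply: eq_bigr => s _; rewrite !mulr_sumr; apply: eq_bigr => u _; ring.
Qed.

Let op_sym f g : dot f (op g) = dot (op f) g.
Proof.
have -> : dot (op f) g = dot g (op f) by apply: eq_bigr => s _; rewrite [_ * g s]mulrC.
rewrite !dot_form exchange_big; apply: eq_bigr => s _; apply: eq_bigr => u _.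
by rewrite reversible [_ * g _]mulrC.
Qed.

Let op_mean g : \sum_s m s * op g s = \sum_s m s * g s.
Proof.
have := op_sym (fun=> 1) g.
rewrite /dot (eq_bigr (fun s => m s * op g s)); last by move=> s _; rewrite mul1r.
move=> ->; apply: eq_bigr => s _; rewrite /op.
by under eq_bigr do rewrite mulr1; rewrite P_sum1 mul1r.
Qed.

Let dot_ge0 f : 0 <= dot f f.
Proof. by apply: sumr_ge0 => s _; rewrite mulr_ge0 ?(ltW (m_gt0 s))// -expr2 sqr_ge0. Qed.

Let dot_eq0 f : dot f f = 0 -> forall s, f s = 0.
Proof.
have nn u : xpredT u -> 0 <= m u * (f u * f u).
  by rewrite mulr_ge0 ?(ltW (m_gt0 _))// -expr2 sqr_ge0.
move=> /(psumr_eq0P nn) h s; have /eqP := h s isT.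
by rewrite mulf_eq0 gt_eqF//= mulf_eq0 orbb => /eqP.
Qed.

Let mean0 f := \sum_s m s * f s = 0.

(** The unit sphere of mean-zero functions is compact, since positive weights bound every
    coordinate. Functions are encoded as row vectors to place the sphere in a product of
    segments. *)
Let rayleigh_max h : mean0 h -> 0 < dot h h -> exists f,
  [/\ mean0 f, dot f f = 1 & forall g, mean0 g -> dot g g = 1 -> dot g (op g) <= dot f (op f)].
Proof.
move=> h0 hh.
pose F (v : 'rV[R]_#|T|) s : R := v ord0 (enum_rank s).
pose V f : 'rV[R]_#|T| := \row_j f (enum_val j).
have FV f : F (V f) = f by apply/funext => s; rewrite /F mxE enum_rankK.
have cF s : continuous (F ^~ s) by exact: coord_continuous.
have csum (G : T -> 'rV[R]_#|T| -> R) : (forall s, continuous (G s)) ->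
    continuous (fun v => \sum_s G s v).
  by move=> hG; apply: continuous_big => //; exact: add_continuous.
have cmul (c : R) (G H : 'rV[R]_#|T| -> R) : continuous G -> continuous H ->
    continuous (fun v => c * (G v * H v)).
  move=> hG hH v; apply: (@continuousM _ _ (cst c) (fun v => G v * H v)).
    exact: cst_continuous.
  by apply: (@continuousM _ _ G H); [exact: hG|exact: hH].
have cmean : continuous (fun v => \sum_s m s * F v s).
  apply: csum => s v; apply: (@continuousM _ _ (cst (m s)) (F ^~ s)).
    exact: cst_continuous.
  exact: cF.
have cdot : continuous (fun v => dot (F v) (F v)).
  by apply: csum => s; exact: cmul.
have cform : continuous (fun v => dot (F v) (op (F v))).
  rewrite (_ : (fun _ => _) = (fun v => \sum_s \sum_u m s * P s u * (F v s * F v u))).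
    by apply: (csum) => s; apply: (csum) => u; exact: cmul.
  by apply/funext => v; rewrite dot_form.
pose A := [set v : 'rV[R]_#|T| | mean0 (F v) /\ dot (F v) (F v) = 1]%classic.
have A0 : (A !=set0)%classic.
  exists (V (fun s => h s / Num.sqrt (dot h h))); rewrite /A /= FV; split.
    rewrite /mean0 (eq_bigr (fun s => m s * h s / Num.sqrt (dot h h))).
      by rewrite -mulr_suml h0 mul0r.
    by move=> s _; rewrite mulrA.
  rewrite /dot (eq_bigr (fun s => m s * (h s * h s) / (Num.sqrt (dot h h) ^+ 2))).
    by rewrite -mulr_suml sqr_sqrtr ?dot_ge0// mulfV// gt_eqF.
  by move=> s _; field; rewrite gt_eqF// sqrtr_gt0.
have clA : closed A.
  have -> : A = ((fun v => \sum_s m s * F v s) @^-1` [set x | x = 0] `&`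
     (fun v => dot (F v) (F v)) @^-1` [set x | x = 1])%classic by [].
  by apply: closedI; [move/continuous_closedP: cmean|move/continuous_closedP: cdot]; apply; exact: closed_eq.
have cA : compact A.
  (* [x ^ 2 <= y] implies [x <= y + 1], which avoids a square root. *)
  pose M s := (m s)^-1 + 1.
  have := @rV_compact R #|T| (fun j => `[- M (enum_val j), M (enum_val j)]%classic)
    (fun j => @segment_compact R _ _).
  move=> cB; apply: (subclosed_compact clA cB) => v [_ v1] j /=.
  have h1 : m (enum_val j) * (F v (enum_val j)) ^+ 2 <= 1.
    rewrite -[leRHS]v1 /dot (bigD1 (enum_val j))//= expr2 lerDl.
    by apply: sumr_ge0 => s _; rewrite mulr_ge0 ?(ltW (m_gt0 s))// -expr2 sqr_ge0.
  move: h1; rewrite /F enum_valK in_itv /= -ler_norml.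
  rewrite mulrC -ler_pdivlMr// div1r -real_normK ?num_real// /M.
  have : 0 < (m (enum_val j))^-1 by rewrite invr_gt0.
  move: (_^-1) => y y0; set x := `|_| => xy; have x0 : 0 <= x by exact: normr_ge0.
  by nra.
have [v /set_mem[v0 v1] vmax] := compact_EVT_max A0 cA (continuous_subspaceT cform).
exists (F v); split => // g g0 g1.
by have := vmax (V g); rewrite FV; apply; apply/mem_set; rewrite /A /= FV.
Qed.

(** At a maximizer the residual [op f - l f] is orthogonal to all mean-zero functions. It has mean
    zero itself, so it vanishes. *)
Lemma reversible_eigenfunction h : \sum_s m s * h s = 0 ->
  0 < \sum_s m s * h s ^+ 2 -> exists l f,
  [/\ \sum_s m s * f s = 0, exists s, f s != 0,
      forall s, \sum_u P s u * f u = l * f s &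
      \sum_s m s * (h s * \sum_u P s u * h u) <= l * \sum_s m s * h s ^+ 2].
Proof.
move=> h0 hh.
have dh : \sum_s m s * h s ^+ 2 = dot h h by apply: eq_bigr => s _; rewrite expr2.
rewrite dh in hh *.
have [f [f0 f1 fmax]] := rayleigh_max h0 hh.
pose l := dot f (op f).
have ub g : mean0 g -> dot g (op g) <= l * dot g g.
  move=> g0; have [gg|/eqP gg] := eqVneq (dot g g) 0.
    rewrite gg mulr0 /dot big1// => s _; rewrite (dot_eq0 gg) mul0r mulr0//.
  have gp : 0 < dot g g by rewrite lt_neqAle dot_ge0 eq_sym; apply/andP; split => //; apply/eqP.
  pose r := Num.sqrt (dot g g).
  have r2 : r ^+ 2 = dot g g by rewrite sqr_sqrtr ?dot_ge0.
  have r0 : r != 0 by rewrite gt_eqF// sqrtr_gt0.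
  have := fmax (fun s => g s / r); rewrite -/l.
  have -> : dot (fun s => g s / r) (fun s => g s / r) = dot g g / r ^+ 2.
    by rewrite /dot mulr_suml; apply: eq_bigr => s _; field.
  have -> : dot (fun s => g s / r) (op (fun s => g s / r)) = dot g (op g) / r ^+ 2.
    rewrite !dot_form mulr_suml; apply: eq_bigr => s _; rewrite mulr_suml.
    by apply: eq_bigr => u _; field.
  rewrite r2 mulfV ?gt_eqF// => /(_ _ erefl); rewrite ler_pdivrMr//; apply.
  rewrite /mean0 (eq_bigr (fun s => m s * g s / r)).
    by rewrite -mulr_suml g0 mul0r.
  by move=> s _; rewrite mulrA.
have first_order g : mean0 g -> dot (fun s => op f s - l * f s) g = 0.
  move=> g0; set a := dot _ g; pose b := l * dot g g - dot g (op g).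
  have q t : 2 * t * a <= t ^+ 2 * b.
    have mt : mean0 (fun s => f s + t * g s).
      rewrite /mean0 (eq_bigr (fun s => m s * f s + t * (m s * g s))).
        by rewrite big_split/= -mulr_sumr f0 g0 mulr0 addr0.
      by move=> s _; ring.
    have := ub _ mt.
    have -> : dot (fun s => f s + t * g s) (fun s => f s + t * g s) =
        dot f f + 2 * t * dot f g + t ^+ 2 * dot g g.
      rewrite /dot !mulr_sumr -!big_split/=; apply: eq_bigr => s _; ring.
    rewrite f1.
    have -> : dot (fun s => f s + t * g s) (op (fun s => f s + t * g s)) =
        l + 2 * t * dot (op f) g + t ^+ 2 * dot g (op g).
      have -> : 2 * t * dot (op f) g = t * dot (op f) g + t * dot f (op g).
        by rewrite op_sym; ring.
      have -> : dot (op f) g = dot g (op f) by apply: eq_bigr => s _; rewrite [_ * g s]mulrC.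
      rewrite /l !dot_form !mulr_sumr -!big_split/=; apply: eq_bigr => s _.
      by rewrite !mulr_sumr -!big_split/=; apply: eq_bigr => u _; ring.
    have -> : a = dot (op f) g - l * dot f g.
      by rewrite /a /dot mulr_sumr -sumrB; apply: eq_bigr => s _; ring.
    by rewrite /b; lra.
  have B0 : 0 < `|b| + 1 by rewrite ltr_wpDl.
  have hb : b <= `|b| by exact: ler_norm.
  (* A linear term bounded by a quadratic one for all [t] is zero; this [t] gives
     [2 a^2 (|b| + 1) <= a^2 b]. *)
  have := q (a / (`|b| + 1)).
  rewrite -(@ler_pM2r _ ((`|b| + 1) ^+ 2)) ?exprn_gt0//.
  have -> : 2 * (a / (`|b| + 1)) * a * (`|b| + 1) ^+ 2 = 2 * a ^+ 2 * (`|b| + 1).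
    by field; rewrite gt_eqF.
  have -> : (a / (`|b| + 1)) ^+ 2 * b * (`|b| + 1) ^+ 2 = a ^+ 2 * b.
    by field; rewrite gt_eqF.
  move=> hq; apply/eqP; rewrite -sqrf_eq0 eq_le sqr_ge0 andbT.
  have a2 := sqr_ge0 a; have b0 : 0 <= `|b| by [].
  by move: (`|b|) b0 hb hq => c c0 hb hq; nra.
exists l, f; split => //.
- apply/existsP; rewrite -[X in is_true X]negbK negb_exists; apply/negP => /forallP z.
  move: f1; rewrite /dot big1 => [/eqP|s _]; first by rewrite eq_sym oner_eq0.
  by have := z s; rewrite negbK => /eqP ->; rewrite mul0r mulr0.
- move=> s; apply/eqP; rewrite -subr_eq0; apply/eqP.
  have z0 : mean0 (fun s => op f s - l * f s).
    rewrite /mean0 (eq_bigr (fun s => m s * op f s - l * (m s * f s))).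
      by rewrite sumrB -mulr_sumr op_mean f0 mulr0 subr0.
    by move=> u _; ring.
  exact: (dot_eq0 (first_order _ z0)).
- exact: ub.
Qed.

End Rayleigh.

(** * The slow mode *)

Section SlowMode.
Variables (R : realType) (n : nat) (beta : R).
Hypothesis n_gt0 : (0 < n)%N.
Local Notation mu := (@cw_mu R n beta).
Implicit Types (s u z : config n) (w f : config n -> R).

Definition flip s : config n := [ffun x => ~~ s x].

Lemma flipK : involutive flip.
Proof. by move=> s; apply/ffunP => x; rewrite !ffunE negbK. Qed.

Lemma mag_flip s : mag R (flip s) = - mag R s.
Proof.
rewrite /mag -sumrN; apply: eq_bigr => x _; rewrite ffunE /spin.
by case: (s x) => //=; rewrite opprK.
Qed.

Lemma mag_mean0 : \sum_s mu s * mag R s = 0.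
Proof.
suff h : \sum_s mu s * mag R s = - \sum_s mu s * mag R s by lra.
rewrite {1}(reindex_inj (inv_inj flipK)) -sumrN; apply: eq_bigr => s _.
by rewrite /cw_mu !cw_weight_mag mag_flip sqrrN mulrN.
Qed.

(** [w] is a signed measure of mass 0, so subtracting [mu] from every row of the kernel leaves
    [a ^+ t * w] unchanged; its l1 norm is then bounded row by row. *)
Lemma left_eigen_decay w (a : R) : (exists s, w s != 0) -> \sum_s w s = 0 ->
  (forall u, \sum_s w s * glauber beta s u = a * w u) ->
  forall t, `|a| ^+ t <= 2 * dmax n beta t.
Proof.
move=> [s0 ws0] w0 wP t.
have wPt u : \sum_s w s * glauber_t beta t s u = a ^+ t * w u.
  elim: t u => [|t IH] u.
    rewrite (bigD1 u)//= glauber_t0 eqxx mulr1 big1 ?addr0 ?mul1r// => s su.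
    by rewrite glauber_t0 (negbTE su) mulr0.
  under eq_bigr do rewrite glauber_tS mulr_sumr.
  rewrite exchange_big exprS -mulrA -IH mulr_sumr /=; apply: eq_bigr => z _.
  under eq_bigr do rewrite mulrA.
  by rewrite -mulr_suml wP mulrA.
have W0 : 0 < \sum_s `|w s|.
  rewrite (bigD1 s0)//= ltr_pwDl ?normr_gt0//.
  by apply: sumr_ge0 => s _; exact: normr_ge0.
rewrite -(ler_pM2r W0) mulr_sumr.
apply: (@le_trans _ _ (\sum_u \sum_s `|w s| * `|glauber_t beta t s u - mu u|)).
  apply: ler_sum => u _; rewrite -normrX -normrM -wPt.
  have -> : \sum_s w s * glauber_t beta t s u =
      \sum_s w s * (glauber_t beta t s u - mu u).
    under [RHS]eq_bigr do rewrite mulrBr.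
    by rewrite sumrB -mulr_suml w0 mul0r subr0.
  apply: le_trans (ler_norm_sum _ _ _) _; apply: ler_sum => s _.
  by rewrite normrM.
rewrite exchange_big mulr_sumr /=; apply: ler_sum => s _.
rewrite -mulr_sumr mulrC ler_wpM2r// -ler_pdivrMl//.
exact: tv_dist_le_dmax.
Qed.

(** [eigenvalue] refers to row vectors, hence to signed measures. The kernel preserves mass, so
    [a != 1] forces mass 0. *)
Lemma eigenvalue_decay (a : R) : eigenvalue (glauber_mx n beta) a -> a != 1 ->
  forall t, `|a| ^+ t <= 2 * dmax n beta t.
Proof.
move=> /eigenvalueP[v va v0] a1.
pose w s := v ord0 (enum_rank s).
have wP u : \sum_s w s * glauber beta s u = a * w u.
  have := congr1 (fun M : 'rV_#|{: config n}| => M ord0 (enum_rank u)) va.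
  rewrite !mxE => <-; rewrite [RHS](reindex (@enum_rank (config n)))/=; last first.
    by apply: onW_bij; exact: enum_rank_bij.
  by apply: eq_bigr => s _; rewrite mxE !enum_rankK.
apply: (left_eigen_decay _ _ wP).
- move/rV0Pn: v0 => [j vj]; exists (enum_val j); rewrite /w enum_valK.
  by move: vj; rewrite (ord1 ord0).
- have : \sum_u a * w u = \sum_s w s.
    under eq_bigr do rewrite -wP.
    rewrite exchange_big; apply: eq_bigr => s _ /=.
    by rewrite -mulr_sumr glauber_sum1// mulr1.
  rewrite -mulr_sumr => /eqP; rewrite -subr_eq0 -{2}[\sum_s w s]mul1r -mulrBl.
  by rewrite mulf_eq0 subr_eq0 (negbTE a1) => /eqP.
Qed.

Lemma slow_eigenvalue (T : nat) : `|beta - 1| <= 100^-1 -> n%:R^-1 <= 100^-1 :> R ->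
  0 < \sum_s mu s * mag R s ^+ 2 -> dmax n beta T <= 4^-1 -> exists l : R,
  [/\ eigenvalue (glauber_mx n beta) l, l != 1 &
      (1 - l) * \sum_s mu s * mag R s ^+ 2 <= 2].
Proof.
move=> near1 nl V0 dT; set V := \sum_s _ in V0 *.
have [l [f [f0 [s0 fs0] fl lV]]] := reversible_eigenfunction
  (@cw_mu_gt0 R n beta) (@glauber_reversible R n beta)
  (fun s => glauber_sum1 beta s n_gt0) mag_mean0 V0.
pose w s := mu s * f s.
have w0 : exists s, w s != 0 by exists s0; rewrite mulf_neq0// gt_eqF// cw_mu_gt0.
have wP u : \sum_s w s * glauber beta s u = l * w u.
  rewrite /w [RHS]mulrCA -fl mulr_sumr; apply: eq_bigr => s _.
  by rewrite mulrAC glauber_reversible -mulrA.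
exists l; split.
- apply/eigenvalueP; exists (\row_j w (enum_val j)).
    apply/rowP => j; rewrite !mxE -wP (reindex (@enum_rank (config n)))/=; last first.
      by apply: onW_bij; exact: enum_rank_bij.
    by apply: eq_bigr => s _; rewrite !mxE !enum_rankK.
  have [s ws] := w0; apply/rV0Pn; exists (enum_rank s).
  by rewrite mxE enum_rankK.
(* Eigenvalue 1 on a nonzero measure of mass 0 would give [1 <= 2 * d(T) <= 1/2]. *)
- have := left_eigen_decay w0 f0 wP T; apply: contraTneq => ->.
  by rewrite normr1 expr1n -ltNge; lra.
(* Stationarity of [S^2] replaces the drift in [<S, P S>] by [p + q <= 1], so that
   [V - 2 <= <S, P S> <= l * V]. *)
- have E : \sum_s mu s * (mag R s * glauber_op beta (@mag R n) s) =
      V + 2^-1 * (\sum_s mu s * (4 * mag R s * (up_rate n beta (plus s) - down_rate n beta (plus s)))).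
    rewrite /V mulr_sumr -big_split/=; apply: eq_bigr => s _.
    have := glauber_op_mag beta n_gt0 id s; rewrite -[id \o _]/(@mag R n) => ->.
    by field.
  have := stationary_mag beta n_gt0 (fun x => x ^+ 2).
  rewrite (eq_bigr (fun s => mu s * (4 * mag R s * (up_rate n beta (plus s) - down_rate n beta (plus s))) + 4 * (mu s * (up_rate n beta (plus s) + down_rate n beta (plus s))))); last first.
    by move=> s _; ring.
  rewrite big_split/= -mulr_sumr.
  have : \sum_s mu s * (up_rate n beta (plus s) + down_rate n beta (plus s)) <= 1.
    rewrite -(cw_mu_sum1 n beta); apply: ler_sum => s _.
    rewrite ler_piMr ?(ltW (cw_mu_gt0 _ _))//.
    by have /andP[] := rate_tot_bnd n_gt0 near1 nl s.
  move: lV; rewrite -/V -/(glauber_op beta (@mag R n) _) E.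
  set X := \sum_s mu s * (4 * _ * _).
  set Y := \sum_s mu s * (_ + _).
  lra.
Qed.

(** * Submultiplicativity of the distance and the mixing time *)

Lemma glauber_tD t1 t2 s u : glauber_t beta (t1 + t2) s u =
  \sum_z glauber_t beta t1 s z * glauber_t beta t2 z u.
Proof.
rewrite /glauber_t exprD mxE (reindex (@enum_rank (config n)))//=.
by apply: onW_bij; exact: enum_rank_bij.
Qed.

Lemma glauber_t_sum1 t s : \sum_u glauber_t beta t s u = 1.
Proof.
have := glauber_tE beta t (fun=> 1) s; under eq_bigr do rewrite mulr1.
move=> ->; elim: t s => //= t IH s.
rewrite -[RHS](glauber_op_const beta 1 s n_gt0).
by congr (glauber_op _ _ s); apply/funext => u; exact: IH.
Qed.

Lemma glauber_t_mu t u : \sum_s mu s * glauber_t beta t s u = mu u.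
Proof.
elim: t u => [|t IH] u.
  rewrite (bigD1 u)//= glauber_t0 eqxx mulr1 big1 ?addr0// => s su.
  by rewrite glauber_t0 (negbTE su) mulr0.
under eq_bigr do rewrite glauber_tS mulr_sumr.
rewrite exchange_big -[RHS]IH /=; apply: eq_bigr => z _.
under eq_bigr do rewrite mulrA glauber_reversible mulrAC.
by rewrite -mulr_sumr glauber_sum1// mulr1.
Qed.

Lemma dmax_ge0 t : 0 <= dmax n beta t.
Proof. by rewrite /dmax; exact: bigmax_ge_id. Qed.

(** Subtracting [mu] from every row of the kernels leaves their composition rule intact, by
    stationarity and unit row sums. *)
Lemma dmax_submul t1 t2 : dmax n beta (t1 + t2) <= 2 * dmax n beta t1 * dmax n beta t2.
Proof.
rewrite {1}/dmax; apply/bigmax_leP; split.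
  by rewrite !mulr_ge0// dmax_ge0.
move=> s _; rewrite {1}/tv_dist ler_pdivrMl//.
apply: (@le_trans _ _ (\sum_u \sum_z `|glauber_t beta t1 s z - mu z| *
    `|glauber_t beta t2 z u - mu u|)).
  apply: ler_sum => u _.
  have -> : glauber_t beta (t1 + t2) s u - mu u = \sum_z
      (glauber_t beta t1 s z - mu z) * (glauber_t beta t2 z u - mu u).
    rewrite (eq_bigr (fun z => glauber_t beta t1 s z * glauber_t beta t2 z u -
      mu z * glauber_t beta t2 z u - (glauber_t beta t1 s z - mu z) * mu u)); last first.
      by move=> z _; ring.
    rewrite !sumrB -glauber_tD glauber_t_mu -mulr_suml sumrB glauber_t_sum1.
    by rewrite cw_mu_sum1 subrr mul0r subr0.
  apply: le_trans (ler_norm_sum _ _ _) _; apply: ler_sum => z _.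
  by rewrite normrM.
rewrite exchange_big /=.
apply: (@le_trans _ _ (\sum_z `|glauber_t beta t1 s z - mu z| * (2 * dmax n beta t2))).
  apply: ler_sum => z _; rewrite -mulr_sumr ler_wpM2l// -ler_pdivrMl//.
  exact: tv_dist_le_dmax.
rewrite -mulr_suml.
have -> : 2 * (2 * dmax n beta t1 * dmax n beta t2) =
  2 * dmax n beta t1 * (2 * dmax n beta t2) by ring.
rewrite ler_wpM2r ?mulr_ge0 ?dmax_ge0// -ler_pdivrMl//.
exact: tv_dist_le_dmax.
Qed.

(** This makes [tmix] a genuine minimum at every positive level instead of the default 0. Each
    further [T] steps at least halve the distance, so [1 / (k + 1)] is a safe bound. *)
Lemma dmax_small T (e : R) : dmax n beta T <= 4^-1 -> 0 < e ->
  exists t, dmax n beta t <= e.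
Proof.
move=> dT e0.
have h k : dmax n beta (k.+1 * T) <= (k.+1%:R)^-1.
  elim: k => [|k IH]; first by rewrite mul1n invr1; apply: le_trans dT _; lra.
  rewrite mulSn; apply: le_trans (dmax_submul _ _) _.
  have d0 := dmax_ge0 (k.+1 * T).
  have k0 : 0 < k.+1%:R :> R by rewrite ltr0n.
  have k1 : 1 <= k.+1%:R :> R by rewrite ler1n.
  apply: (@le_trans _ _ (2^-1 * k.+1%:R^-1)).
    by apply: ler_pM => //; rewrite ?mulr_ge0 ?dmax_ge0//; lra.
  rewrite -invfM lef_pV2 ?posrE ?mulr_gt0 ?ltr0n//.
  by rewrite -(natr1 k.+1); lra.
have [N hN] := natr_large e^-1.
exists (N.+1 * T)%N; apply: le_trans (h N) _.
by rewrite invf_ple ?posrE ?ltr0n//; apply: hN.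
Qed.

Lemma tmix_spec (e : R) : (exists t, dmax n beta t <= e) -> dmax n beta (tmix n beta e) <= e.
Proof. by rewrite /tmix => h; case: pselect => // h'; case: ex_minnP. Qed.

Lemma tmix_min (e : R) t : dmax n beta t <= e -> (tmix n beta e <= t)%N.
Proof.
by move=> h; rewrite /tmix; case: pselect => // h'; case: ex_minnP => m _; apply.
Qed.

End SlowMode.

(** * Assembly of the bounds *)

Lemma bernoulli_le (R : realType) (x : R) t : 0 <= x <= 1 -> 1 - t%:R * x <= (1 - x) ^+ t.
Proof.
move=> /andP[x0 x1]; elim: t => [|t IH]; first by rewrite mul0r subr0 expr0.
rewrite exprS; apply: (@le_trans _ _ ((1 - x) * (1 - t%:R * x))).
  rewrite -subr_ge0 -natr1 (_ : _ - _ = t%:R * x ^+ 2); last by ring.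
  by rewrite mulr_ge0 ?sqr_ge0.
by rewrite ler_wpM2l ?subr_ge0.
Qed.

Lemma expR_decay_le (R : realType) (x : R) t : 0 <= x <= 2^-1 ->
  expR (- (2 * (t%:R * x))) <= (1 - x) ^+ t.
Proof.
move=> /andP[x0 x1].
rewrite (_ : 2 * (t%:R * x) = t%:R * (2 * x)); last by ring.
rewrite -mulrN expRM_natl lerXn2r ?nnegrE ?expR_ge0//; first by lra.
rewrite expRN invf_ple ?posrE ?expR_gt0//; last lra.
apply: le_trans (expR_ge1Dx _); rewrite -div1r ler_pdivrMr; last lra.
by nra.
Qed.

Lemma critical_window (R : realType) (K : R) : 0 < K ->
  exists C D : R, [/\ 0 < C, 0 < D & exists N : nat,
  forall (n : nat) (beta : R), (N <= n)%N -> `|beta - 1| <= K / Num.sqrt n%:R ->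
  [/\ (0 < n)%N, 2 * D <= n%:R * Num.sqrt n%:R,
     exists T, [/\ (0 < T)%N, T%:R <= C * (n%:R * Num.sqrt n%:R) & dmax n beta T <= 4^-1] &
     exists l, [/\ eigenvalue (glauber_mx n beta) l, l != 1 &
       1 - D / (n%:R * Num.sqrt n%:R) <= l]]].
Proof.
move=> K0; have [C C0 [N1 hN1]] := mixing_upper K0.
have [c c0 [N2 hN2]] := variance_lower K0.
exists C, (2 / c); split => //; first by rewrite divr_gt0.
have [N3 hN3] := natr_large (100 : R).
have [N4 hN4] := natr_large ((100 * K) ^+ 2).
have [N5 hN5] := natr_large (2 * (2 / c)).
exists (maxn N1 (maxn N2 (maxn N3 (maxn N4 N5)))) => n beta.
rewrite !geq_max => /and5P[/hN1 U /hN2 V /hN3 n3 /hN4 n4 /hN5 n5] near.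
have nR : 0 < n%:R :> R by lra.
have n0 : (0 < n)%N by rewrite -(ltr0n R).
have near1 := window_small K0 nR n4 near.
have nl : n%:R^-1 <= 100^-1 :> R by rewrite lef_pV2 ?posrE.
have q0 := nsqrt_gt0 R n0.
have {U}[T [T0 TC dT]] := U _ near.
have {}V := V _ near.
split => //.
- apply: le_trans n5 _; rewrite -[leLHS]mulr1 ler_pM2l//.
  exact: sqrt_ge1.
- by exists T.
- have V0 : 0 < \sum_(s : config n) cw_mu beta s * mag R s ^+ 2.
    by apply: lt_le_trans V; rewrite mulr_gt0.
  have [l [el l1 hl]] := slow_eigenvalue n0 near1 nl V0 dT.
  exists l; split => //.
  have [l2|l2] := leP 1 l.
    by apply: le_trans l2; rewrite gerBl divr_ge0 ?(ltW q0)// divr_ge0// ltW.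
  have : 1 - l <= 2 / (c * (n%:R * Num.sqrt n%:R)).
    rewrite ler_pdivlMr; last exact: mulr_gt0.
    apply: le_trans hl.
    by rewrite ler_wpM2l//; lra.
  by rewrite invfM mulrA; lra.
Qed.

Theorem theorem2 (R : realType) (beta : nat -> R)
  (hbeta0 : forall n : nat, 0 <= beta n)
  (hdelta : exists K : R, exists N : nat, forall n : nat, (N <= n)%N ->
              `|beta n - 1| <= K / Num.sqrt (n%:R)) :
  @has_order R (fun n => (tmix n (beta n) (4^-1))%:R)
            (fun n => n%:R * Num.sqrt (n%:R)) /\
  ~ @has_cutoff R beta /\
  @has_order R (fun n => spectral_gap n (beta n))
            (fun n => (n%:R * Num.sqrt (n%:R))^-1).
Proof.
have [K [N0 hK]] := hdelta.
(* The given [K] may be negative or zero. *)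
have K0 : 0 < `|K| + 1 by rewrite ltr_wpDl.
have [C [D [C0 D0 [N1 hN1]]]] := critical_window K0.
pose q (n : nat) : R := n%:R * Num.sqrt n%:R.
pose N := maxn N0 N1.
have core n : (N <= n)%N -> [/\ (0 < n)%N, 2 * D <= q n,
     exists T, [/\ (0 < T)%N, T%:R <= C * q n & dmax n (beta n) T <= 4^-1] &
     exists l, [/\ eigenvalue (glauber_mx n (beta n)) l, l != 1 & 1 - D / q n <= l]].
  rewrite geq_max => /andP[/hK nK n1]; apply: hN1 => //.
  apply: le_trans nK _; rewrite ler_wpM2r ?invr_ge0//.
  by apply: le_trans (ler_norm K) _; rewrite lerDl.
have upper n : (N <= n)%N -> (tmix n (beta n) 4^-1)%:R <= C * q n.
  move=> /core[_ _ [T [_ TC dT]] _]; apply: le_trans TC.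
  by rewrite ler_nat; exact: tmix_min.
have Dq n : (N <= n)%N -> 0 < q n /\ 0 <= D / q n <= 2^-1.
  move=> /core[n0 hD _ _]; have q0 : 0 < q n by exact: nsqrt_gt0.
  split=> //; rewrite divr_ge0 ?(ltW D0) ?(ltW q0)//= ler_pdivrMr//; lra.
have decay n t : (N <= n)%N -> (1 - D / q n) ^+ t <= 2 * dmax n (beta n) t.
  move=> nN; have [n0 _ _ [l [el l1 hl]]] := core n nN.
  have [q0 /andP[x0 x1]] := Dq n nN.
  apply: le_trans (eigenvalue_decay n0 el l1 t).
  rewrite lerXn2r ?nnegrE//; first by lra.
  by apply: le_trans hl _; exact: ler_norm.
have ex n e : (N <= n)%N -> 0 < e -> exists t, dmax n (beta n) t <= e.
  by move=> /core[n0 _ [T [_ _ dT]] _]; exact: (dmax_small n0 dT).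
split; last split.
(* The upper constant is raised by the lower one to make it strictly larger. *)
- exists (4 * D)^-1, (C + (4 * D)^-1).
  have c0 : 0 < (4 * D)^-1 by rewrite invr_gt0; apply: mulr_gt0.
  split => //; split; first by rewrite ltrDr.
  exists N => n nN; have [q0 x01] := Dq n nN; apply/andP; split; last first.
    by apply: le_trans (upper n nN) _; rewrite ler_pM2r// lerDl ltW.
  have x01' : 0 <= D / q n <= 1 by case/andP: x01 => -> /=; lra.
  have := tmix_spec (ex n 4^-1 nN ltac:(lra)); move: (tmix _ _ _) => t dt.
  have := le_trans (bernoulli_le t x01') (decay n t nN) => h1.
  have : 2^-1 <= t%:R * (D / q n) by lra.
  rewrite mulrA ler_pdivlMr// => h3.
  rewrite -/(q n) mulrC ler_pdivrMr ?mulr_gt0//; lra.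
- move=> [w [w1 w2]].
  (* Before time [(C + 1) * q n] the slow mode keeps [2 * d(t) >= E = 4 * e]. So [tmix e] is at
     least [(C + 1) * q n], while [tmix (1 - e)] is at most [C * q n]. *)
  pose E := expR (- (2 * ((C + 1) * D))).
  have E0 : 0 < E by exact: expR_gt0.
  have E1 : E <= 1.
    by rewrite -[leRHS]expR0 ler_expR oppr_le0 !mulr_ge0// ?ltW//; lra.
  pose e := E / 4.
  have [c [c0 hc]] := w2 e ltac:(rewrite /e; lra).
  (* With this tolerance [c * w n] is at most [q n / 2], half of the separation of the two times. *)
  have [N2 hN2] := w1 (2 * c * C)^-1 ltac:(by rewrite invr_gt0 !mulr_gt0).
  pose n := maxn N N2.
  have nN : (N <= n)%N by rewrite leq_maxl.
  have [n0 _ _ _] := core n nN; have [q0 x01] := Dq n nN.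
  have slow : (C + 1) * q n <= (tmix n (beta n) e)%:R.
    have := tmix_spec (ex n e nN ltac:(rewrite /e; lra)); move: (tmix _ _ _) => t dt.
    rewrite leNgt; apply/negP => ht.
    have := le_trans (expR_decay_le t x01) (decay n t nN).
    have : E <= expR (- (2 * (t%:R * (D / q n)))).
      rewrite ler_expR lerN2 ler_pM2l// mulrA ler_pdivrMr//.
      by rewrite mulrAC ler_pM2r// ltW.
    by move: dt; rewrite /e; lra.
  have fast : (tmix n (beta n) (1 - e))%:R <= C * q n.
    apply: le_trans (upper n nN); rewrite ler_nat; apply: tmix_min.
    apply: le_trans (tmix_spec (ex n 4^-1 nN ltac:(lra))) _.
    by rewrite /e; lra.
  have := hc n n0; have := hN2 n (leq_maxr _ _).
  have u := upper n nN; set tm := (tmix n (beta n) 4^-1)%:R in u *.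
  move=> /(le_trans (ler_norm _)) hw hc'.
  have : c * w n <= c * ((2 * c * C)^-1 * (C * q n)).
    rewrite ler_pM2l//; apply: le_trans hw _.
    by rewrite ler_wpM2l// invr_ge0 !mulr_ge0 // ltW.
  have -> : c * ((2 * c * C)^-1 * (C * q n)) = q n / 2 by field; rewrite !gt_eqF.
  by lra.
- exists (2 * C)^-1, (D + (2 * C)^-1).
  have c0 : 0 < (2 * C)^-1 by rewrite invr_gt0; apply: mulr_gt0.
  split => //; split; first by rewrite ltrDr.
  exists N => n nN; have [n0 _ [T [T0 TC dT]] [l [el l1 hl]]] := core n nN.
  have [q0 /andP[x0 x1]] := Dq n nN.
  have TR : 0 < T%:R :> R by rewrite ltr0n.
  have T1 : 1 <= T%:R :> R by rewrite ler1n.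
  pose S := [set `|a| | a in [set a : R | eigenvalue (glauber_mx n (beta n)) a && (a != 1)]]%classic.
  have Sl : S `|l| by exists l => //=; rewrite el.
  (* [|a| ^ T <= 2 * d(T) <= 1/2] and the Bernoulli inequality; the bound also ensures that [sup S]
     is a true supremum. *)
  have ubS : ubound S (1 - (2 * T%:R)^-1).
    move=> _ [a /= /andP[ea a1] <-]; rewrite leNgt; apply/negP => ha.
    have y01 : 0 <= (2 * T%:R)^-1 :> R /\ (2 * T%:R)^-1 <= 1 :> R.
      by rewrite invr_ge0 mulr_ge0// invf_le1 ?mulr_gt0//; split => //; lra.
    move/andP: y01 => y01.
    have h1 : (1 - (2 * T%:R)^-1) ^+ T < `|a| ^+ T.
      by rewrite ltrXn2r ?nnegrE// ?subr_ge0 -?lt0n//; case/andP: y01.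
    have := lt_le_trans (le_lt_trans (bernoulli_le T y01) h1) (eigenvalue_decay n0 ea a1 T).
    have -> : T%:R * (2 * T%:R)^-1 = 2^-1 :> R by field; rewrite gt_eqF.
    by lra.
  rewrite /spectral_gap /lambda_star -/S -/(q n); apply/andP; split.
    have h : sup S <= 1 - (2 * T%:R)^-1 by apply: ge_sup => //; exists `|l|.
    have : (2 * C)^-1 / q n <= (2 * T%:R)^-1.
      have C2 : 0 < 2 * C * q n by apply: mulr_gt0 => //; exact: mulr_gt0.
      have T2 : 0 < 2 * T%:R :> R by exact: mulr_gt0.
      by rewrite -invfM lef_pV2 ?posrE// -mulrA ler_pM2l.
    lra.
  have h : `|l| <= sup S by apply: ub_le_sup => //; exists (1 - (2 * T%:R)^-1).
  have : 0 <= (2 * C)^-1 / q n by rewrite divr_ge0 // ltW.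
  have := ler_norm l; rewrite mulrDl; lra.
Qed.
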